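(* Let a mapping $s:\mathbb{B}(\mathcal{T})\to\mathcal{C}$ be given. Then there exists a Schur multiplier $S\in\mathbf{H}(\mathcal{T})$ such that $$s(c)=S^\wedge(c)\qquad\text{for all } c\in\mathbb{B}(\mathcal{T})$$ if and only if the kernel $K_s:\mathbb{B}(\mathcal{T})\times\mathbb{B}(\mathcal{T})\to\mathcal{C}$ defined by $$K_s(c,d):=\sum_{n=0}^\infty(c\alpha)^n\big(I-s(c)s(d)^*\big)(d\alpha)^{n*},\qquad c,d\in\mathbb{B}(\mathcal{T}),$$ is positive, i.e. for any $m\ge 0$, $c_0,\dots,c_m\in\mathbb{B}(\mathcal{T})$ and $k_0,\dots,k_m\in\mathcal{C}_2$ it holds that $$\sum_{i,j=0}^m\langle K_s(c_i,c_j)k_j,k_i\rangle_2\ge 0.$$ In this case $K_s(c,d)=(K_S^d)^\wedge(c)$ for all $c,d\in\mathbb{B}(\mathcal{T})$, where $$K_S^d:=(I-S\,S^\wedge(d)^* )K_\wedge^d,\qquad d\in\mathbb{B}(\mathcal{T}).$$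
   Context: Tree setting. Let $q\ge 1$ be an integer and $\mathcal{T}$ a homogeneous tree of order $q$, i.e. an acyclic, undirected, connected graph such that every node belongs to exactly $q+1$ edges. An infinite path from $t$ is a sequence of nodes $(t_0=t,t_1,t_2,\dots)$ with consecutive nodes joined by an edge and $t_{k+1}\neq t_k\neq t_{k+2}$ for all $k$. Two infinite paths $(t_k),(s_k)$ are equivalent if there are $m,n\ge 0$ with $t_{m+k}=s_{n+k}$ for all $k\ge 0$; equivalence classes are boundary points. Fix a boundary point $\infty_{\mathcal{T}}$; each node $t$ has a unique representative path of $\infty_{\mathcal{T}}$ starting at $t$. For nodes $t,s$ with representative paths $(t_k),(s_k)$ of $\infty_{\mathcal{T}}$, take the minimal $m,n$ with $t_{m+k}=s_{n+k}$ for all $k\ge0$, and set $s\wedge t:=t_m=s_n$, $\operatorname{dist}(s,t):=m+n$. Write $s\preceq t$ if $\operatorname{dist}(s,s\wedge t)\le\operatorname{dist}(t,s\wedge t)$ and $s\asymp t$ if equality holds. Fix maps (primitive shifts) $\alpha_1,\dots,\alpha_q:\mathcal{T}\to\mathcal{T}$, acting on the right, with $\{t\alpha_1,\dots,t\alpha_q\}=\{s: t\preceq s,\ \operatorname{dist}(t,s)=1\}$ for every $t$. Let $\mathcal{F}_q$ be the free semigroup with unit $\emptyset$ generated by $\alpha_1,\dots,\alpha_q$; $|\emptyset|=0$, $|\alpha_{i_1}\cdots\alpha_{i_n}|=n$; $w\in\mathcal{F}_q$ acts on nodes by $t\mapsto tw$. Operators. $\ell_2(\mathcal{T})$ is the Hilbert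 space of square-summable functions $f:\mathcal{T}\to\mathbb{C}$ with standard basis $\chi_t$; $\mathbf{X}(\mathcal{T})$ is the algebra of bounded linear operators on it, with operator norm $\|\cdot\|$. Each $w\in\mathcal{F}_q$ is also regarded as the operator $(wf)(t)=f(tw)$ in $\mathbf{X}(\mathcal{T})$, with adjoint $w^*$. $S\in\mathbf{X}(\mathcal{T})$ is causal if for every node $s$ and $f\in\ell_2(\mathcal{T})$ with $f(t)=0$ for all $t\preceq s$, one has $(Sf)(t)=0$ for all $t\preceq s$. $\mathbf{H}(\mathcal{T})$ is the algebra of causal operators and $\mathcal{C}=\{S\in\mathbf{X}(\mathcal{T}): S,S^*\in\mathbf{H}(\mathcal{T})\}$ is the algebra of constants. Each $S\in\mathbf{H}(\mathcal{T})$ has coefficients $S_{[w]}\in\mathcal{C}$ ($w\in\mathcal{F}_q$) given by $(S_{[w]}\chi_t)(s)=(S\chi_t)(sw)$ if $t\asymp s$ and $0$ otherwise, and $S=\sum_{w\in\mathcal{F}_q}w^*S_{[w]}$ (for every $f,t$ the series evaluated at $f$ and $t$ converges absolutely to $(Sf)(t)$). Point evaluation. Let $\alpha$ be the column of operators $\alpha_1,\dots,\alpha_q$. For a row $c=(c_1\ \dots\ c_q)\in\mathcal{C}^q$ put $c\alpha=\sum_j c_j\alpha_j$ and $\alpha^*c^*=(c\alpha)^*=\sum_j\alpha_j^*c_j^*$. Set $\mathbb{B}(\mathcal{T})=\{c\in\mathcal{C}^q:\lim_{n\to\infty}\|(c\alpha)^n\|^{1/n}<1\}$. For $S\in\mathbf{H}(\mathcal{T})$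 and $c\in\mathbb{B}(\mathcal{T})$, $S^\wedge(c):=\sum_{n=0}^\infty(c\alpha)^n\big(\sum_{|w|=n}w^*S_{[w]}\big)$, which converges absolutely in operator norm to an element of $\mathcal{C}$. Here $(d\alpha)^{n*}$ denotes $((d\alpha)^n)^*$. For $d\in\mathbb{B}(\mathcal{T})$, $K_\wedge^d:=(I-\alpha^*d^* )^{-1}\in\mathbf{H}(\mathcal{T})$. Hilbert–Schmidt spaces. $\mathbf{H}_2(\mathcal{T})=\{F\in\mathbf{H}(\mathcal{T}):\|F\|_2^2:=\operatorname{trace}(F^*F)<\infty\}$ with $\langle F,G\rangle_2=\operatorname{trace}(G^*F)$, and $\mathcal{C}_2=\mathcal{C}\cap\mathbf{H}_2(\mathcal{T})$. A Schur multiplier is an operator $S\in\mathbf{H}(\mathcal{T})$ with $\|S\|\le 1$. *)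

(* Defs.v *)
From HB Require Import structures.
From mathcomp Require Import all_boot all_order all_algebra.
From mathcomp Require Import complex lra.
From mathcomp Require Import all_classical all_reals all_analysis.

Set Implicit Arguments.
Unset Strict Implicit.
Unset Printing Implicit Defensive.

Import Order.TTheory GRing.Theory Num.Theory.
Import numFieldNormedType.Exports.

Local Open Scope classical_set_scope.
Local Open Scope ring_scope.
Local Open Scope complex_scope.

Section tree.
Variables (q : nat) (T : choiceType) (e : rel T).

Definition connected_graph :=
  forall s t, exists p, path e s p /\ last s p = t.

Definition acyclic_graph :=
  forall p : seq T, (2 < size p)%N -> uniq p -> ~~ cycle e p.

Definition homogeneous_tree :=
  [/\ symmetric e, irreflexive e, connected_graph, acyclic_graph &
      forall t, ([set s | e t s] #= `I_q.+1)%card].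

Definition infinite_path (p : nat -> T) :=
  forall k, [/\ e (p k) (p k.+1), p k.+1 != p k & p k != p k.+2].

Definition equivalent_paths (p r : nat -> T) :=
  exists m n, forall k, p (m + k)%N = r (n + k)%N.

Definition boundary_point (oo : set (nat -> T)) :=
  exists2 p, infinite_path p &
    oo = [set r | infinite_path r /\ equivalent_paths p r].

Variable oo : set (nat -> T).

(* The representative of oo starting at t; it is unique in a tree. *)
Definition rep (t : T) : nat -> T :=
  xget (fun=> t) [set p | oo p /\ p 0%N = t].

(* The least m such that the representative of s, after m steps, follows the
   representative of t.  As the pairs (m, n) with s_(m+k) = t_(n+k) for all k
   are the translates (m0 + l, n0 + l) of a single pair (m0, n0), the minimal
   pair is (hops s t, hops t s). *)
Definition hops (s t : T) : nat :=
  let P := [set m | exists n, forall k, rep s (m + k)%N = rep t (n + k)%N] in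
  xget 0%N [set m | P m /\ forall m', P m' -> (m <= m')%N].

Definition meet (s t : T) : T := rep s (hops s t).

Definition dist (s t : T) : nat := (hops s t + hops t s)%N.

Definition preceq (s t : T) : Prop :=
  (dist s (meet s t) <= dist t (meet s t))%N.

Definition asymp (s t : T) : Prop :=
  dist s (meet s t) = dist t (meet s t).

Definition primitive_shifts (alpha : 'I_q -> T -> T) :=
  forall t, range (alpha ^~ t) = [set s | preceq t s /\ dist t s = 1%N].

(* Elements of the free semigroup are words in the indices of the generators;
   the leftmost letter acts first. *)
Definition act (alpha : 'I_q -> T -> T) (t : T) (w : seq 'I_q) : T :=
  foldl (fun u i => alpha i u) t w.

End tree.

Section l2_space.
Variables (R : realType) (T : choiceType).

(* [normc] is the modulus with values in R; the norm `|z| lies in R[i]. *)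
Local Notation normc := (@ComplexField.Normc.normc R).

Definition sqsum (f : T -> R[i]) : \bar R :=
  \esum_(t in setT) (normc (f t) ^+ 2)%:E.

Definition l2 : {pred (T -> R[i])} := [pred f | (sqsum f < +oo)%E].

Lemma normc_ge0 (z : R[i]) : 0 <= normc z.
Proof. by case: z => x y; exact: sqrtr_ge0. Qed.

Lemma l2_submod_closed : submod_closed l2.
Proof.
split=> [|a f g]; rewrite !inE /sqsum.
  by rewrite esum1 => [|t _]; rewrite ?ltry//= expr0n/= addr0 sqrtr0 expr0n.
move=> fl2 gl2.
have ge0 (h : T -> R[i]) t : (0 <= (normc (h t) ^+ 2)%:E)%E.
  by rewrite lee_fin sqr_ge0.
have ub t : (normc ((a *: f + g) t) ^+ 2
    <= 2 * normc a ^+ 2 * normc (f t) ^+ 2 + 2 * normc (g t) ^+ 2).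
  have n0 (z : R[i]) : 0 <= normc z by case: z => x y; exact: sqrtr_ge0.
  have -> : (a *: f + g) t = a * f t + g t by [].
  have := le_normcD (a * f t) (g t).
  rewrite ComplexField.Normc.normcM => le_w.
  have : normc (a * f t + g t) ^+ 2 <= (normc a * normc (f t) + normc (g t)) ^+ 2.
    by rewrite lerXn2r ?nnegrE ?addr_ge0 ?mulr_ge0// normc_ge0.
  have := sqr_ge0 (normc a * normc (f t) - normc (g t)).
  by rewrite sqrrB sqrrD exprMn; lra.
apply: (@le_lt_trans _ _ (\esum_(t in setT)
   (((2 * normc a ^+ 2)%:E * (normc (f t) ^+ 2)%:E) +
     2%:E * (normc (g t) ^+ 2)%:E))%E).
  by apply: le_esum => t _; rewrite -!EFinM -EFinD lee_fin.
have a0 : 0 <= 2 * normc a ^+ 2 by rewrite mulr_ge0// sqr_ge0.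
rewrite esumD => [|t _|t _]; rewrite ?mule_ge0//.
have fin (c : R) (h : T -> R[i]) : 0 <= c ->
    (\esum_(t in setT) (normc (h t) ^+ 2)%:E < +oo)%E ->
    (\esum_(t in setT) (c%:E * (normc (h t) ^+ 2)%:E) < +oo)%E.
  move=> c0 hl2; apply: (@le_lt_trans _ _
    (c%:E * \esum_(t in setT) (normc (h t) ^+ 2)%:E)%E).
    rewrite ge_ereal_sup// => _ [X [finX XT]] <-.
    rewrite -ge0_mule_fsumr// lee_wpmul2l ?lee_fin//.
    by rewrite esum_ge//; exists X.
  rewrite lte_mul_pinfty ?lee_fin//.
by rewrite lte_add_pinfty// fin.
Qed.


HB.instance Definition _ :=
  GRing.isSubmodClosed.Build R[i] (T -> R[i]) l2 l2_submod_closed.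

Record ell2 := Ell2 { ell2_fun :> T -> R[i]; _ : ell2_fun \in l2 }.

HB.instance Definition _ := [isSub for ell2_fun].
HB.instance Definition _ := [Choice of ell2 by <:].
HB.instance Definition _ := [SubChoice_isSubLmodule of ell2 by <:].

Lemma l2_delta (t : T) : (fun s => (s == t)%:R) \in l2.
Proof.
rewrite inE /sqsum (_ : esum _ _ = \esum_(s in [set t]) 1%:E).
  by rewrite esum_set1 ?ltry.
rewrite [RHS]esum_mkcond; apply: eq_esum => s _.
have [->|st] := eqVneq s t.
  by rewrite mem_set// ComplexField.Normc.normc1 expr1n.
rewrite memNset/=; last exact/eqP.
by rewrite expr0n/= addr0 sqrtr0 expr0n.
Qed.

Definition chi (t : T) : ell2 := Ell2 (l2_delta t).

Definition l2norm (f : ell2) : R := Num.sqrt (fine (sqsum f)).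

(* Unordered sums of reals and of complex numbers over T, meaningful for
   absolutely summable families. *)
Definition rsum (f : T -> R) : R :=
  fine (\esum_(t in setT) ((fun u => (f u)%:E)^\+%E t)) -
  fine (\esum_(t in setT) ((fun u => (f u)%:E)^\-%E t)).

Definition csum (f : T -> R[i]) : R[i] :=
  rsum (fun t => complex.Re (f t)) +i* rsum (fun t => complex.Im (f t)).

Definition inner (f g : ell2) : R[i] := csum (fun t => f t * (g t)^*).

(* The elements of X(T) are the maps satisfying [bounded_op]; addition is
   pointwise, multiplication is composition, powers are iterates. *)
Definition oper : Type := ell2 -> ell2.

Definition bounded_op (A : oper) : Prop :=
  linear A /\ exists M : R, forall f, l2norm (A f) <= M * l2norm f.

Definition opnorm (A : oper) : R :=
  sup [set l2norm (A f) | f in [set f | l2norm f <= 1]].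

Definition adjoint (A : oper) : oper :=
  xget 0 [set B | bounded_op B /\ forall f g, inner (A f) g = inner f (B g)].

Definition op_inv (A : oper) : oper :=
  xget 0 [set B | [/\ bounded_op B, A \o B = idfun & B \o A = idfun]].

Definition op_series (u : nat -> oper) : oper :=
  xget 0 [set A | bounded_op A /\
    (fun n => opnorm (\sum_(0 <= k < n) u k - A)) @ \oo --> (0 : R)].

Definition op_trace (A : oper) : R[i] :=
  csum (fun t => inner (A (chi t)) (chi t)).

Definition hs_inner (F G : oper) : R[i] := op_trace (adjoint G \o F).

(* trace (F^* F) < +oo; the diagonal entries of F^* F are nonnegative reals. *)
Definition hilbert_schmidt (F : oper) : Prop :=
  (\esum_(t in setT)
     (complex.Re (inner ((adjoint F \o F) (chi t)) (chi t)))%:E < +oo)%E.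

End l2_space.

Arguments oper : clear implicits.

Section causal.
Variables (R : realType) (T : choiceType) (oo : set (nat -> T)).
Local Notation oper := (oper R T).
Implicit Types A S F : oper.

Definition causal S : Prop :=
  bounded_op S /\
  forall (s : T) (f : ell2 R T), (forall t, preceq oo t s -> f t = 0) ->
    forall t, preceq oo t s -> S f t = 0.

Definition constant_op S : Prop := causal S /\ causal (adjoint S).

Definition H2 F : Prop := causal F /\ hilbert_schmidt F.

Definition C2 F : Prop := constant_op F /\ H2 F.

Definition schur_multiplier S : Prop := causal S /\ opnorm S <= 1.

Variables (q : nat) (alpha : 'I_q -> T -> T).

(* The operator (w f)(t) = f(tw).  For primitive shifts t |-> tw is injective,
   so f(tw) is square summable in t and the default value 0 is not used. *)
Definition word_op (w : seq 'I_q) : oper :=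
  fun f => insubd 0 (fun t => f (act alpha t w)).

Definition coef S (w : seq 'I_q) : oper :=
  xget 0 [set A | bounded_op A /\ forall t s : T,
    A (chi R t) s = if `[< asymp oo t s >] then S (chi R t) (act alpha s w)
                    else 0].

Definition row_alpha (c : 'I_q -> oper) : oper :=
  \sum_(j < q) (c j \o word_op [:: j]).

Definition op_ball (c : 'I_q -> oper) : Prop :=
  (forall j, constant_op (c j)) /\
  exists2 l : R, l < 1 &
    (fun n => opnorm (iter n (row_alpha c)) `^ (n%:R^-1)) @ \oo --> l.

Definition point_eval S (c : 'I_q -> oper) : oper :=
  op_series (fun n => iter n (row_alpha c) \o
    \sum_(w : n.-tuple 'I_q) (adjoint (word_op w) \o coef S w)).

Definition szego (d : 'I_q -> oper) : oper :=
  op_inv (idfun - adjoint (row_alpha d)).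

Definition schur_kernel (s : ('I_q -> oper) -> oper) (c d : 'I_q -> oper)
    : oper :=
  op_series (fun n => iter n (row_alpha c) \o
    (idfun - (s c \o adjoint (s d))) \o adjoint (iter n (row_alpha d))).

Definition positive_kernel (K : ('I_q -> oper) -> ('I_q -> oper) -> oper) :=
  forall (m : nat) (c : 'I_m.+1 -> 'I_q -> oper) (k : 'I_m.+1 -> oper),
    (forall i, op_ball (c i)) -> (forall i, C2 (k i)) ->
    0 <= \sum_i \sum_j hs_inner (K (c i) (c j) \o k j) (k i).

Definition multiplier_kernel S (d : 'I_q -> oper) : oper :=
  (idfun - (S \o adjoint (point_eval S d))) \o szego d.

End causal.

(* Main.v *)
Require Import Defs.
From mathcomp Require Import all_boot all_order all_algebra.
From mathcomp Require Import complex lra ring zify.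
From mathcomp Require Import all_classical all_reals all_analysis.

Set Implicit Arguments.
Unset Strict Implicit.
Unset Printing Implicit Defensive.

Import Order.TTheory GRing.Theory Num.Theory.
Import numFieldNormedType.Exports.

Local Open Scope classical_set_scope.
Local Open Scope ring_scope.

(** The levels of the tree, counted from the boundary point, grade l2: a
    causal operator is one that does not lower levels, a constant one that
    preserves them, and [B := row_alpha alpha c] is an operator of degree -1.
    The powers of such a [B] have different degrees, so [N := (1 - B)^-1]
    exists with explicit entries as soon as they decay geometrically
    ([neumann_spec]), and all the series in the statement are diagonals of
    products: with [diag] the part of degree 0,

      S^(c) = diag (N_c S),   K_s(c, d) = diag (N_c (1 - s(c) s(d)^* ) N_d^* )

    ([point_eval_series], [kernel_series]).

    Let [s = diag (N S)]. The entry of degree [- m] of [N (S - s)] is [B^m]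
    applied to [diag (N (S - s)) = 0], so [N (S - s)] is strictly causal
    ([residual_strictly_causal]). Hence [S] may replace [s(c)] in the kernel
    ([kernel_identity]), which is the formula for [K_S^d]; and for [x] on the
    level [n], the vector [s(c)^* N^* x] is the part of [S^* N^* x] on the
    levels from [n] on ([adjoint_eval_agree]).

    On vectors [x_i] of one level, with [phi_i = N_i^* x_i], the kernel is

      sum_ij <K(c_i, c_j) x_j, x_i> =
        |sum_i phi_i|^2 - |sum_i s(c_i)^* phi_i|^2

    ([kernel_quadratic]). If [s] comes from a contraction [S], the second
    vector is a part of [S^* (sum_i phi_i)], so this is nonnegative, and the
    traces in the definition of positivity are sums of such terms over the
    basis ([multiplier_positive_kernel]).

    Conversely, testing positivity on rank one operators says that, for each
    level [n], [N^* x -> s(c)^* N^* x] for [x] on level [n] extends to a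
    contraction from a span. Among the rows in the ball are nilpotent ones
    that make [N^* x] the sum of the basis vectors along any finite descending
    chain from level [n] ([adjoint_neumann_chain]); differences of two chains
    are basis vectors, so the span is dense in the part of l2 on the levels
    from [n] on. The contractions for different [n] are compressions of each
    other ([column_stable]), hence are the compressions of one contraction,
    which is the adjoint of the multiplier sought ([positive_kernel_multiplier]). *)

(** * Unconditional sums of complex families *)

Section sums.
Variables (R : realType) (T : choiceType).
Local Notation C := (complex R).
Local Notation normc := (@ComplexField.Normc.normc R).

Lemma normc_sum (I : Type) (s : seq I) (f : I -> C) :
  normc (\sum_(i <- s) f i) <= \sum_(i <- s) normc (f i).
Proof.
elim/big_ind2: _ => [|x a y b xa yb|//].
  by rewrite ComplexField.Normc.normc0.
by rewrite (le_trans (le_normcD _ _))// lerD.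
Qed.

Lemma normcB (x y : C) : normc (x - y) = normc (y - x).
Proof. by rewrite -normcN opprB. Qed.

Lemma normc_triangle (y x z : C) : normc (x - z) <= normc (x - y) + normc (y - z).
Proof. by rewrite (le_trans _ (le_normcD _ _))// addrA subrK. Qed.

Lemma normc_le_Re_Im (z : C) :
  normc z <= `|complex.Re z| + `|complex.Im z|.
Proof.
case: z => x y /=; rewrite -[leRHS]ger0_norm ?addr_ge0// -sqrtr_sqr.
rewrite ler_wsqrtr// sqrrD !real_normK ?num_real// -addrA lerD2l.
by rewrite lerDr mulrn_wge0// mulr_ge0.
Qed.

Lemma Re_le_normc (z : C) : `|complex.Re z| <= normc z.
Proof.
by case: z => x y /=; rewrite -sqrtr_sqr ler_wsqrtr// lerDl sqr_ge0.
Qed.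

Lemma Im_le_normc (z : C) : `|complex.Im z| <= normc z.
Proof.
by case: z => x y /=; rewrite -sqrtr_sqr ler_wsqrtr// lerDr sqr_ge0.
Qed.

Lemma normc_le0 (z : C) : normc z <= 0 -> z = 0.
Proof.
move=> z0; apply: ComplexField.Normc.eq0_normc; apply/eqP.
by rewrite eq_le z0 normc_ge0.
Qed.

Lemma normc_conj (z : C) : normc z^* = normc z.
Proof. by case: z => x y /=; rewrite sqrrN. Qed.

Lemma mulc_conj (z : C) : z * z^* = (normc z ^+ 2)%:C%C.
Proof.
case: z => x y; simpc; rewrite /= sqr_sqrtr ?addr_ge0 ?sqr_ge0// !expr2.
by congr (_ +i* _)%C; rewrite mulrC addNr.
Qed.

(** A bound for all finite sums of moduli; it makes the sum of the family
    converge unconditionally. *)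
Definition abs_bounded (f : T -> C) (M : R) : Prop :=
  forall s, uniq s -> \sum_(t <- s) normc (f t) <= M.

(** Convergence along the finite subsets, the form in which linearity, norm
    bounds and positivity pass to the sum at once. *)
Definition has_sum (f : T -> C) (l : C) : Prop :=
  forall eps : R, 0 < eps -> exists2 s : seq T, uniq s &
    forall s', uniq s' -> {subset s <= s'} ->
      normc (\sum_(t <- s') f t - l) <= eps.

Lemma esum_bounded (a : T -> R) (M : R) : (forall t, 0 <= a t) ->
  (forall s, uniq s -> \sum_(t <- s) a t <= M) ->
  exists v : R, [/\ (\esum_(t in setT) (a t)%:E = v%:E)%E, v <= M,
    forall s, uniq s -> \sum_(t <- s) a t <= v &
    forall eps, 0 < eps -> exists2 s, uniq s & v - eps < \sum_(t <- s) a t].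
Proof.
move=> a0 aM; pose v := (\esum_(t in setT) (a t)%:E)%E.
have fsE (X : set T) : finite_set X ->
    (\sum_(t \in X) (a t)%:E = (\sum_(t <- finmap.enum_fset (fset_set X)) a t)%:E)%E.
  by move=> finX; rewrite fsbig_finite//= sumEFin.
have vM : (v <= M%:E)%E.
  rewrite ge_ereal_sup// => _ [X [finX _]] <-.
  by rewrite fsE// lee_fin aM// finmap.fset_uniq.
have v0 : (0 <= v)%E by apply: esum_ge0 => t _; rewrite lee_fin.
have vE : v = (fine v)%:E.
  rewrite fineK// fin_numE -ltey -ltNye (lt_le_trans _ v0) ?ltNyr//.
  by rewrite (le_lt_trans vM) ?ltry.
exists (fine v); split => //.
- by rewrite -lee_fin -vE.
- move=> s us; rewrite -lee_fin -vE; apply: esum_ge.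
  exists [set` s]; first by split => //; exact: finite_seq.
  by rewrite -fsbig_seq// sumEFin.
- move=> eps e0.
  have [|_ [X [finX _] <-]] := @ub_ereal_sup_adherent R
    [set (\sum_(t \in A) (a t)%:E)%E | A in fsets setT] _ e0.
    by rewrite -/(esum setT (fun t => (a t)%:E)) -/v vE.
  rewrite -/(esum setT (fun t => (a t)%:E)) -/v vE fsE// -EFinB lte_fin => h.
  by exists (finmap.enum_fset (fset_set X)) => //; exact: finmap.fset_uniq.
Qed.

Lemma sum_uniq_subset (a : T -> R) (s s' : seq T) : (forall t, 0 <= a t) ->
  uniq s -> uniq s' -> {subset s <= s'} ->
  \sum_(t <- s) a t <= \sum_(t <- s') a t.
Proof.
move=> a0 us us' ss'; rewrite [leRHS](bigID (mem s))/= -[leLHS]addr0 lerD//.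
  rewrite -[leRHS]big_filter (perm_big [seq x <- s' | x \in s])//.
  apply: uniq_perm; rewrite ?filter_uniq// => x.
  by rewrite mem_filter; case: (boolP (x \in s)) => // /ss' ->.
by rewrite sumr_ge0.
Qed.

(** The positive and the negative part are each almost exhausted by a finite
    set, and every set containing both is as good. *)
Lemma rsum_approx (f : T -> R) (M : R) :
  (forall s, uniq s -> \sum_(t <- s) `|f t| <= M) ->
  forall eps : R, 0 < eps -> exists2 s : seq T, uniq s &
    forall s', uniq s' -> {subset s <= s'} ->
      `|\sum_(t <- s') f t - rsum f| <= eps.
Proof.
move=> fM eps e0.
pose p t := Num.max (f t) 0; pose n t := Num.max (- f t) 0.
have p0 t : 0 <= p t by rewrite le_max lexx orbT.
have n0 t : 0 <= n t by rewrite le_max lexx orbT.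
have pf t : p t <= `|f t| by rewrite ge_max ler_norm normr_ge0.
have nf t : n t <= `|f t| by rewrite ge_max -normrN ler_norm normr_ge0.
have [|vp [vpE _ lep gep]] := @esum_bounded p M p0.
  by move=> s us; rewrite (le_trans _ (fM s us))// ler_sum.
have [|vn [vnE _ len gen]] := @esum_bounded n M n0.
  by move=> s us; rewrite (le_trans _ (fM s us))// ler_sum.
have rsumE : rsum f = vp - vn.
  rewrite /rsum; congr (_ - _).
  - rewrite (_ : esum _ _ = vp%:E)// -vpE; apply: eq_esum => t _.
    by rewrite funeposE -EFin_max.
  - rewrite (_ : esum _ _ = vn%:E)// -vnE; apply: eq_esum => t _.
    by rewrite funenegE -EFinN -EFin_max.
have e2 : 0 < eps / 2 by rewrite divr_gt0.
have [sp usp hsp] := gep _ e2; have [sn usn hsn] := gen _ e2.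
exists (undup (sp ++ sn)); first exact: undup_uniq.
move=> s' us' sub.
have subp : {subset sp <= s'}.
  by move=> x xs; apply: sub; rewrite mem_undup mem_cat xs.
have subn : {subset sn <= s'}.
  by move=> x xs; apply: sub; rewrite mem_undup mem_cat xs orbT.
have fpn t : f t = p t - n t.
  rewrite /p /n /Num.max; case: ltP => h1; case: ltP => h2; lra.
have -> : \sum_(t <- s') f t = \sum_(t <- s') p t - \sum_(t <- s') n t.
  by rewrite -sumrB; apply: eq_bigr => t _.
have := sum_uniq_subset p0 usp us' subp.
have := sum_uniq_subset n0 usn us' subn.
have := lep _ us'; have := len _ us'; rewrite rsumE ler_norml; lra.
Qed.

Lemma has_sum_csum (f : T -> C) (M : R) : abs_bounded f M -> has_sum f (csum f).
Proof.
move=> fM eps e0; have e2 : 0 < eps / 2 by rewrite divr_gt0.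
have [|s1 us1 h1] := @rsum_approx (fun t => complex.Re (f t)) M _ _ e2.
  move=> s us; rewrite (le_trans _ (fM s us))// ler_sum// => t _.
  exact: Re_le_normc.
have [|s2 us2 h2] := @rsum_approx (fun t => complex.Im (f t)) M _ _ e2.
  move=> s us; rewrite (le_trans _ (fM s us))// ler_sum// => t _.
  exact: Im_le_normc.
exists (undup (s1 ++ s2)); first exact: undup_uniq.
move=> s' us' sub; apply: le_trans (normc_le_Re_Im _) _.
rewrite [leRHS]splitr.
have ReS (s : seq T) : complex.Re (\sum_(t <- s) f t) = \sum_(t <- s) complex.Re (f t).
  by elim/big_rec2 : _ => // t y x _ <-; case: (f t) x => [? ?] [? ?].
have ImS (s : seq T) : complex.Im (\sum_(t <- s) f t) = \sum_(t <- s) complex.Im (f t).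
  by elim/big_rec2 : _ => // t y x _ <-; case: (f t) x => [? ?] [? ?].
have ReB (x y : C) : complex.Re (x - y) = complex.Re x - complex.Re y.
  by case: x y => [? ?] [? ?].
have ImB (x y : C) : complex.Im (x - y) = complex.Im x - complex.Im y.
  by case: x y => [? ?] [? ?].
rewrite ReB ImB ReS ImS; apply: lerD.
  by apply: h1 => // x xs; apply: sub; rewrite mem_undup mem_cat xs.
by apply: h2 => // x xs; apply: sub; rewrite mem_undup mem_cat xs orbT.
Qed.

Lemma has_sum_unique (f : T -> C) (l l' : C) :
  has_sum f l -> has_sum f l' -> l = l'.
Proof.
move=> fl fl'; apply/subr0_eq/normc_le0/ler_addgt0Pr => eps e0.
have e2 : 0 < eps / 2 by rewrite divr_gt0.
have [s us hs] := fl _ e2; have [s' us' hs'] := fl' _ e2.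
pose u := undup (s ++ s').
rewrite add0r [leRHS]splitr; apply: le_trans (normc_triangle (\sum_(t <- u) f t) _ _) _.
rewrite [X in X + _]normcB; apply: lerD.
  by apply: hs; rewrite ?undup_uniq// => x xs; rewrite mem_undup mem_cat xs.
by apply: hs'; rewrite ?undup_uniq// => x xs; rewrite mem_undup mem_cat xs orbT.
Qed.

Lemma has_sumE (f : T -> C) (M : R) (l : C) :
  abs_bounded f M -> has_sum f l -> csum f = l.
Proof. by move=> /has_sum_csum; exact: has_sum_unique. Qed.

Lemma has_sumD (f g : T -> C) (l m : C) :
  has_sum f l -> has_sum g m -> has_sum (fun t => f t + g t) (l + m).
Proof.
move=> fl gm eps e0; have e2 : 0 < eps / 2 by rewrite divr_gt0.
have [s us hs] := fl _ e2; have [s' us' hs'] := gm _ e2.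
exists (undup (s ++ s')); first exact: undup_uniq.
move=> u uu sub; rewrite big_split/= opprD addrACA.
rewrite (le_trans (le_normcD _ _))// [leRHS]splitr; apply: lerD.
  by apply: hs => // x xs; apply: sub; rewrite mem_undup mem_cat xs.
by apply: hs' => // x xs; apply: sub; rewrite mem_undup mem_cat xs orbT.
Qed.

Lemma has_sumZ (a : C) (f : T -> C) (l : C) :
  has_sum f l -> has_sum (fun t => a * f t) (a * l).
Proof.
move=> fl eps e0; have n1 : 0 < normc a + 1 by rewrite ltr_wpDl ?normc_ge0.
have [s us hs] := fl _ (divr_gt0 e0 n1); exists s => // u uu sub.
rewrite -mulr_sumr -mulrBr ComplexField.Normc.normcM.
apply: (@le_trans _ _ (normc a * (eps / (normc a + 1)))).
  by rewrite ler_wpM2l ?normc_ge0// hs.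
by rewrite mulrCA ler_piMr ?(ltW e0)// ler_pdivrMr// mul1r lerDl.
Qed.

Lemma has_sum_conj (f : T -> C) (l : C) :
  has_sum f l -> has_sum (fun t => (f t)^*) (l^*).
Proof.
move=> fl eps e0; have [s us hs] := fl _ e0; exists s => // u uu sub.
by rewrite -raddf_sum -raddfB normc_conj hs.
Qed.

Lemma has_sum_fin (f : T -> C) (s : seq T) : uniq s ->
  (forall t, t \notin s -> f t = 0) -> has_sum f (\sum_(t <- s) f t).
Proof.
move=> us f0 eps e0; exists s => // u uu sub.
rewrite (bigID (mem s))/= [X in _ + X - _]big1; last by move=> t /f0.
rewrite -big_filter (perm_big s); last first.
  apply: uniq_perm; rewrite ?filter_uniq// => x.
  by rewrite mem_filter; case: (boolP (x \in s)) => // /sub ->.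
by rewrite addr0 subrr ComplexField.Normc.normc0 ltW.
Qed.

Lemma has_sum_norm (f : T -> C) (M : R) (l : C) :
  abs_bounded f M -> has_sum f l -> normc l <= M.
Proof.
move=> fM fl; apply/ler_addgt0Pr => eps e0; have [s us hs] := fl _ e0.
have := hs s us (fun x h => h); have := fM s us; have := normc_sum s f.
have := normc_triangle (\sum_(t <- s) f t) l 0.
by rewrite !subr0 [normc (l - _)]normcB; lra.
Qed.

Lemma has_sum_ge0 (f : T -> C) (l : C) :
  (forall t, 0 <= f t) -> has_sum f l -> 0 <= l.
Proof.
move=> f0 fl.
have h eps : 0 < eps -> - eps <= complex.Re l /\ `|complex.Im l| <= eps.
  move=> e0; have [s us hs] := fl _ e0.
  have := hs s us (fun x h => h).
  have : 0 <= \sum_(t <- s) f t by rewrite sumr_ge0.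
  move: (\sum_(t <- s) f t) => [x y]; rewrite lecE /= => /andP[/eqP -> x0].
  case: l {fl hs} => [lx ly] le.
  have := le_trans (Im_le_normc _) le; rewrite /= sub0r normrN => ->.
  have := le_trans (Re_le_normc _) le; rewrite /= ler_norml => /andP[_ ?].
  by have {}x0 : 0 <= x := x0; split => //=; lra.
rewrite lecE /=; apply/andP; split.
  rewrite -normr_eq0 eq_le normr_ge0 andbT.
  by apply/ler_addgt0Pr => eps /h[_]; rewrite add0r.
by apply/ler_addgt0Pr => eps /h[+ _]; lra.
Qed.

End sums.
(** * The Hilbert space of square-summable functions *)

Arguments inner : simpl never.
Arguments csum : simpl never.
Arguments chi : simpl never.
Arguments ell2_fun : simpl never.

Section hilbert.
Variables (R : realType) (T : choiceType).
Local Notation C := (complex R).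
Local Notation normc := (@ComplexField.Normc.normc R).
Local Notation ell2 := (ell2 R T).
Implicit Types f g h : ell2.

Lemma conjC_real (x : R) : (x%:C%C : C)^* = x%:C%C.
Proof. exact: conjc_real. Qed.

Lemma ell2P f g : (forall t, f t = g t) -> f = g.
Proof. by move=> fg; apply/val_inj/funext. Qed.

Lemma ell2D f g t : (f + g) t = f t + g t. Proof. by []. Qed.
Lemma ell2B f g t : (f - g) t = f t - g t. Proof. by []. Qed.
Lemma ell2Z (a : C) f t : (a *: f) t = a * f t. Proof. by []. Qed.
Lemma ell20 t : (0 : ell2) t = 0. Proof. by []. Qed.
Lemma ell2_sum (I : Type) (s : seq I) (P : pred I) (F : I -> ell2) t :
  (\sum_(i <- s | P i) F i) t = \sum_(i <- s | P i) F i t.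
Proof. by elim/big_rec2: _ => // i y x _ <-; rewrite ell2D. Qed.

Lemma chiE (t u : T) : (chi R t) u = (u == t)%:R. Proof. by []. Qed.

Lemma sqr_normc_ge0 (f : T -> C) t : 0 <= normc (f t) ^+ 2.
Proof. exact: sqr_ge0. Qed.

Lemma in_l2 (f : T -> C) (M : R) :
  (forall s, uniq s -> \sum_(t <- s) normc (f t) ^+ 2 <= M) -> f \in @l2 R T.
Proof.
move=> fM; have [v [vE _ _ _]] := esum_bounded (sqr_normc_ge0 f) fM.
by rewrite inE /sqsum vE ltry.
Qed.

Lemma l2norm_ge0 f : 0 <= l2norm f. Proof. exact: sqrtr_ge0. Qed.

Lemma l2norm_spec f : [/\ sqsum f = (l2norm f ^+ 2)%:E,
    forall s, uniq s -> \sum_(t <- s) normc (f t) ^+ 2 <= l2norm f ^+ 2 &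
    forall eps, 0 < eps -> exists2 s, uniq s &
      l2norm f ^+ 2 - eps < \sum_(t <- s) normc (f t) ^+ 2].
Proof.
have : (sqsum f < +oo)%E by have := valP f; rewrite inE.
have s0 : (0 <= sqsum f)%E by apply: esum_ge0 => t _; rewrite lee_fin sqr_ge0.
move=> sfin; have fE : sqsum f = (fine (sqsum f))%:E by rewrite fineK// ge0_fin_numE.
have nE : l2norm f ^+ 2 = fine (sqsum f) by rewrite sqr_sqrtr ?fine_ge0.
rewrite nE; case: (@esum_bounded _ _ _ (fine (sqsum f)) (sqr_normc_ge0 f)).
  move=> s us; rewrite -lee_fin -fE; apply: esum_ge.
  exists [set` s]; first by split => //; exact: finite_seq.
  by rewrite -fsbig_seq// sumEFin.
move=> v [vE _ le ge]; rewrite -[esum _ _]/(sqsum f) in vE.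
by rewrite vE.
Qed.

Lemma l2norm_bound f s : uniq s ->
  \sum_(t <- s) normc (f t) ^+ 2 <= l2norm f ^+ 2.
Proof. by have [_ + _] := l2norm_spec f; apply. Qed.

Lemma l2norm_le f (M : R) : 0 <= M ->
  (forall s, uniq s -> \sum_(t <- s) normc (f t) ^+ 2 <= M ^+ 2) ->
  l2norm f <= M.
Proof.
move=> M0 fM; rewrite -ler_sqr ?nnegrE ?l2norm_ge0//.
apply/ler_addgt0Pr => eps e0; have [_ _ /(_ _ e0)[s us]] := l2norm_spec f.
by have := fM s us; lra.
Qed.

Lemma normc_le_l2norm f t : normc (f t) <= l2norm f.
Proof.
rewrite -ler_sqr ?nnegrE ?l2norm_ge0 ?normc_ge0//.
by have := l2norm_bound f (isT : uniq [:: t]); rewrite big_seq1.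
Qed.

(** Since [2 * a * b <= a ^+ 2 + b ^+ 2]; this crude bound also yields
    [cauchy_schwarz] after normalization. *)
Lemma inner_abs_bounded f g :
  abs_bounded (fun t => f t * (g t)^*) ((l2norm f ^+ 2 + l2norm g ^+ 2) / 2).
Proof.
move=> s us; have := l2norm_bound f us; have := l2norm_bound g us => hg hf.
apply: (@le_trans _ _ (\sum_(t <- s) (normc (f t) ^+ 2 + normc (g t) ^+ 2) / 2)).
  apply: ler_sum => t _; rewrite ComplexField.Normc.normcM normc_conj.
  by have := sqr_ge0 (normc (f t) - normc (g t)); rewrite sqrrB; lra.
by rewrite -mulr_suml big_split/=; lra.
Qed.

Lemma has_sum_inner f g : has_sum (fun t => f t * (g t)^*) (inner f g).
Proof. exact: has_sum_csum (inner_abs_bounded f g). Qed.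

Lemma innerE f g l : has_sum (fun t => f t * (g t)^*) l -> inner f g = l.
Proof. exact: has_sumE (inner_abs_bounded f g). Qed.

Lemma eq_has_sum (F G : T -> C) l : F =1 G -> has_sum F l -> has_sum G l.
Proof. by move=> /funext ->. Qed.

Lemma inner_conj f g : inner g f = (inner f g)^*.
Proof.
apply: innerE; apply: eq_has_sum (has_sum_conj (has_sum_inner f g)) => t.
by rewrite rmorphM /= conjCK mulrC.
Qed.

Lemma innerDl f g h : inner (f + g) h = inner f h + inner g h.
Proof.
apply: innerE.
apply: eq_has_sum (has_sumD (has_sum_inner f h) (has_sum_inner g h)) => t.
by rewrite ell2D mulrDl.
Qed.

Lemma innerZl a f h : inner (a *: f) h = a * inner f h.
Proof.
apply: innerE; apply: eq_has_sum (has_sumZ a (has_sum_inner f h)) => t.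
by rewrite ell2Z mulrA.
Qed.

Lemma innerDr f g h : inner h (f + g) = inner h f + inner h g.
Proof. by rewrite inner_conj innerDl rmorphD /= -!inner_conj. Qed.

Lemma innerZr a f h : inner h (a *: f) = a^* * inner h f.
Proof. by rewrite inner_conj innerZl rmorphM /= -inner_conj. Qed.

Lemma inner0l h : inner 0 h = 0.
Proof. by rewrite -(scale0r (0 : ell2)) innerZl mul0r. Qed.

Lemma inner0r h : inner h 0 = 0.
Proof. by rewrite inner_conj inner0l conjC0. Qed.

Lemma innerNl f h : inner (- f) h = - inner f h.
Proof. by rewrite -scaleN1r innerZl mulN1r. Qed.

Lemma innerBl f g h : inner (f - g) h = inner f h - inner g h.
Proof. by rewrite innerDl innerNl. Qed.

Lemma innerBr f g h : inner h (f - g) = inner h f - inner h g.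
Proof. by rewrite inner_conj innerBl rmorphB /= -!inner_conj. Qed.

Lemma inner_suml (I : Type) (s : seq I) (P : pred I) (F : I -> ell2) h :
  inner (\sum_(i <- s | P i) F i) h = \sum_(i <- s | P i) inner (F i) h.
Proof.
elim/big_rec2: _ => [|i y x _ <-]; first exact: inner0l.
by rewrite innerDl.
Qed.

Lemma inner_sumr (I : Type) (s : seq I) (P : pred I) (F : I -> ell2) h :
  inner h (\sum_(i <- s | P i) F i) = \sum_(i <- s | P i) inner h (F i).
Proof.
elim/big_rec2: _ => [|i y x _ <-]; first exact: inner0r.
by rewrite innerDr.
Qed.

Lemma inner_self f : inner f f = (l2norm f ^+ 2)%:C%C.
Proof.
apply: innerE => eps e0; have [_ le /(_ _ e0)[s us h]] := l2norm_spec f.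
exists s => // u uu su.
have -> : \sum_(t <- u) f t * (f t)^* = (\sum_(t <- u) normc (f t) ^+ 2)%:C%C.
  by rewrite rmorph_sum /=; apply: eq_bigr => t _; rewrite mulc_conj.
have := le _ uu; have := sum_uniq_subset (sqr_normc_ge0 f) us uu su.
rewrite -rmorphB /= expr0n /= addr0 sqrtr_sqr ler_norml; lra.
Qed.

Lemma inner_chir f t : inner f (chi R t) = f t.
Proof.
apply: innerE.
have := @has_sum_fin _ _ (fun u => f u * (chi R t u)^*) [:: t] isT.
rewrite big_seq1 chiE eqxx conjC_nat mulr1; apply => u.
by rewrite inE => /negPf ut; rewrite chiE ut conjC_nat mulr0.
Qed.

Lemma inner_chil f t : inner (chi R t) f = (f t)^*.
Proof. by rewrite inner_conj inner_chir. Qed.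

Lemma inner_disjoint f g : (forall t, f t = 0 \/ g t = 0) -> inner f g = 0.
Proof.
move=> fg; apply: innerE => eps e0; exists [::] => // s _ _.
rewrite big1 => [|t _]; last by case: (fg t) => ->; rewrite ?mul0r ?conjC0 ?mulr0.
by rewrite subr0 ComplexField.Normc.normc0 ltW.
Qed.

Lemma l2norm_sqrE f : l2norm f ^+ 2 = complex.Re (inner f f).
Proof. by rewrite inner_self. Qed.

Lemma l2norm0 : l2norm (0 : ell2) = 0.
Proof. by apply/eqP; rewrite -sqrf_eq0 l2norm_sqrE inner0l. Qed.

Lemma l2norm0_eq0 f : l2norm f = 0 -> f = 0.
Proof.
move=> f0; apply: ell2P => t; apply: normc_le0.
by rewrite -f0 normc_le_l2norm.
Qed.

Lemma l2normZ a f : l2norm (a *: f) = normc a * l2norm f.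
Proof.
apply/eqP; rewrite -(@eqrXn2 _ 2) ?mulr_ge0 ?l2norm_ge0 ?normc_ge0//.
rewrite -(inj_eq (@complexI _)) -inner_self innerZl innerZr mulrA mulc_conj.
by rewrite inner_self -rmorphM -exprMn.
Qed.

Lemma l2normN f : l2norm (- f) = l2norm f.
Proof. by rewrite -scaleN1r l2normZ normcN ComplexField.Normc.normc1 mul1r. Qed.

Lemma cauchy_schwarz f g : normc (inner f g) <= l2norm f * l2norm g.
Proof.
have [f0|f0] := eqVneq (l2norm f) 0.
  by rewrite (l2norm0_eq0 f0) inner0l ComplexField.Normc.normc0 l2norm0 mul0r.
have [g0|g0] := eqVneq (l2norm g) 0.
  by rewrite (l2norm0_eq0 g0) inner0r ComplexField.Normc.normc0 l2norm0 mulr0.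
pose a := ((l2norm f)^-1)%:C%C; pose b := ((l2norm g)^-1)%:C%C.
have nr (x : R) : 0 <= x -> normc x%:C%C = x.
  by move=> x0; rewrite /= expr0n /= addr0 sqrtr_sqr ger0_norm.
have := has_sum_norm (@inner_abs_bounded (a *: f) (b *: g)) (has_sum_inner _ _).
rewrite innerZl innerZr !l2normZ conjC_real !ComplexField.Normc.normcM.
rewrite !nr ?invr_ge0 ?l2norm_ge0// !mulVf// expr1n mulrA -invfM.
have p0 : 0 < l2norm f * l2norm g.
  by rewrite mulr_gt0// lt_def l2norm_ge0 ?f0 ?g0.
by rewrite -[1 + 1]/(2%:R) mulfV// ler_pdivrMl// mulr1.
Qed.

Lemma l2norm_addr_sqr f g : l2norm (f + g) ^+ 2 =
  l2norm f ^+ 2 + l2norm g ^+ 2 + complex.Re (inner f g) *+ 2.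
Proof.
rewrite !l2norm_sqrE innerDl !innerDr (inner_conj f g).
by case: (inner f f) (inner f g) (inner g g) => [a b] [c d] [x y] /=; ring.
Qed.

Lemma l2normD f g : l2norm (f + g) <= l2norm f + l2norm g.
Proof.
rewrite -ler_sqr ?nnegrE ?addr_ge0 ?l2norm_ge0// l2norm_addr_sqr sqrrD.
have := le_trans (Re_le_normc _) (cauchy_schwarz f g).
by rewrite ler_norml => /andP[_]; lra.
Qed.

Lemma l2normB f g : l2norm (f - g) = l2norm (g - f).
Proof. by rewrite -l2normN opprB. Qed.

Lemma l2norm_triangle (g f h : ell2) : l2norm (f - h) <= l2norm (f - g) + l2norm (g - h).
Proof. by rewrite (le_trans _ (l2normD _ _))// addrA subrK. Qed.

Lemma l2norm_sum (I : Type) (s : seq I) (F : I -> ell2) :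
  l2norm (\sum_(i <- s) F i) <= \sum_(i <- s) l2norm (F i).
Proof.
elim: s => [|i s IHs]; first by rewrite !big_nil l2norm0.
by rewrite !big_cons (le_trans (l2normD _ _))// lerD.
Qed.

Lemma l2norm_chi (t : T) : l2norm (chi R t) = 1.
Proof.
apply/eqP; rewrite -(@eqrXn2 _ 2) ?l2norm_ge0//.
by rewrite l2norm_sqrE inner_chir chiE eqxx expr1n.
Qed.

Definition fin_comb (s : seq T) (a : T -> C) : ell2 :=
  \sum_(t <- s) a t *: chi R t.

Lemma fin_combE s a u : uniq s ->
  fin_comb s a u = if u \in s then a u else 0.
Proof.
move=> us; rewrite ell2_sum; case: ifPn => [us'|us'].
  rewrite (bigD1_seq u us' us) big1 ?addr0 => [|t tu].
    by rewrite ell2Z chiE eqxx mulr1 /= addr0.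
  by rewrite ell2Z chiE eq_sym (negPf tu) mulr0.
rewrite big1_seq// => t /andP[_ ts]; rewrite ell2Z chiE.
by case: eqVneq => [uE|]; rewrite ?mulr0//; rewrite uE ts in us'.
Qed.

Lemma fin_comb_norm s a : uniq s ->
  l2norm (fin_comb s a) ^+ 2 = \sum_(t <- s) normc (a t) ^+ 2.
Proof.
move=> us; rewrite l2norm_sqrE {1}/fin_comb inner_suml.
have -> : \sum_(t <- s) normc (a t) ^+ 2 =
   complex.Re (\sum_(t <- s) normc (a t) ^+ 2)%:C%C by [].
congr complex.Re; rewrite rmorph_sum /= big_seq [RHS]big_seq.
by apply: eq_bigr => t ts; rewrite innerZl inner_chil fin_combE// ts mulc_conj.
Qed.

Lemma fin_comb_approx f (eps : R) : 0 < eps ->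
  exists2 s, uniq s & l2norm (f - fin_comb s f) <= eps.
Proof.
move=> e0; have [_ le /(_ _ (exprn_gt0 2 e0))[s us h]] := l2norm_spec f.
exists s => //; apply: l2norm_le; first exact: ltW.
move=> u uu; have uv : uniq (undup (s ++ u)) by exact: undup_uniq.
have := le _ uv; rewrite (bigID (mem s))/=.
rewrite -[X in X + _]big_filter (perm_big s); last first.
  apply: uniq_perm; rewrite ?filter_uniq// => x.
  by rewrite mem_filter mem_undup mem_cat; case: (x \in s).
move=> h2; apply: (@le_trans _ _
    (\sum_(t <- undup (s ++ u)) normc ((f - fin_comb s f) t) ^+ 2)).
  apply: sum_uniq_subset => // [t|x xu]; first exact: sqr_ge0.
  by rewrite mem_undup mem_cat xu orbT.
rewrite (bigID (mem s))/= big1 ?add0r => [|t ts].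
  under eq_bigr => t /negPf ts do rewrite ell2B fin_combE// ts subr0.
  by lra.
by rewrite ell2B fin_combE// ts subrr ComplexField.Normc.normc0 expr0n.
Qed.

End hilbert.
(** * Bounded operators *)

Arguments opnorm : simpl never.
Arguments adjoint : simpl never.
Arguments op_series : simpl never.
Arguments op_inv : simpl never.
Arguments l2norm : simpl never.

Section operators.
Variables (R : realType) (T : choiceType).
Local Notation C := (complex R).
Local Notation normc := (@ComplexField.Normc.normc R).
Local Notation ell2 := (ell2 R T).
Local Notation oper := (oper R T).
Local Notation chi := (chi R).
Implicit Types (f g h : ell2) (A B : oper).

(** Finite combinations of basis vectors are dense. *)
Lemma functional_eq0 (D : ell2 -> C) (K : R) :
  (forall f g, D (f + g) = D f + D g) -> (forall a f, D (a *: f) = a * D f) ->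
  (forall f, normc (D f) <= K * l2norm f) -> (forall t, D (chi t) = 0) ->
  forall f, D f = 0.
Proof.
move=> DD DZ DK D0 f; apply/normc_le0/ler_addgt0Pr => eps e0; rewrite add0r.
have K1 : 0 < `|K| + 1 by rewrite ltr_wpDl.
have [s us hs] := fin_comb_approx f (divr_gt0 e0 K1).
have D00 : D 0 = 0 by rewrite -(scale0r (0 : ell2)) DZ mul0r.
have -> : D f = D (f - fin_comb s f).
  rewrite DD -scaleN1r DZ /fin_comb (big_morph D DD D00) big1 ?mulr0 ?addr0//.
  by move=> t _; rewrite DZ D0 mulr0.
apply: le_trans (DK _) _.
apply: (@le_trans _ _ ((`|K| + 1) * (eps / (`|K| + 1)))).
  apply: le_trans (ler_wpM2l (ltW K1) hs); rewrite ler_wpM2r ?l2norm_ge0//.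
  by rewrite (le_trans (ler_norm K))// lerDl.
by rewrite mulrC divfK ?gt_eqF.
Qed.

Lemma lin0 A : linear A -> A 0 = 0.
Proof. by move=> lA; have /= := lA (-1) 0 0; rewrite scaler0 addr0 scaleN1r addNr. Qed.

Lemma linD A f g : linear A -> A (f + g) = A f + A g.
Proof. by move=> lA; have /= := lA 1 f g; rewrite !scale1r. Qed.

Lemma linZ A a f : linear A -> A (a *: f) = a *: A f.
Proof. by move=> lA; have /= := lA a f 0; rewrite (lin0 lA) !addr0. Qed.

Lemma linN A f : linear A -> A (- f) = - A f.
Proof. by move=> lA; rewrite -scaleN1r linZ// scaleN1r. Qed.

Lemma linB A f g : linear A -> A (f - g) = A f - A g.
Proof. by move=> lA; rewrite linD// linN. Qed.

Lemma lin_sum A (I : Type) (s : seq I) (P : pred I) (F : I -> ell2) : linear A ->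
  A (\sum_(i <- s | P i) F i) = \sum_(i <- s | P i) A (F i).
Proof.
move=> lA; elim/big_rec2: _ => [|i y x _ <-]; first exact: lin0.
by rewrite linD.
Qed.

Lemma bounded_lin A : bounded_op A -> linear A. Proof. by case. Qed.

Lemma bounded_opI A (M : R) : linear A ->
  (forall f, l2norm (A f) <= M * l2norm f) -> bounded_op A.
Proof. by move=> lA AM; split=> //; exists M. Qed.

Lemma opnorm_ub A f : bounded_op A -> l2norm (A f) <= opnorm A * l2norm f.
Proof.
move=> [lA [M AM]].
have hs : has_sup [set l2norm (A f) | f in [set f | l2norm f <= 1]].
  split; first by exists (l2norm (A 0)), 0 => //=; rewrite l2norm0.
  exists `|M| => _ [g /= g1 <-]; apply: le_trans (AM g) _.
  apply: le_trans (ler_wpM2r (l2norm_ge0 g) (ler_norm M)) _.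
  exact: ler_piMr.
have [f0|f0] := eqVneq (l2norm f) 0.
  by rewrite (l2norm0_eq0 f0) lin0// !l2norm0 mulr0.
have fp : 0 < l2norm f by rewrite lt_def f0 l2norm_ge0.
have nv : normc ((l2norm f)^-1)%:C%C = (l2norm f)^-1.
  by rewrite /= expr0n /= addr0 sqrtr_sqr ger0_norm// invr_ge0 ltW.
have : l2norm (A (((l2norm f)^-1)%:C%C *: f)) <= opnorm A.
  apply: sup_ubound; first by case: hs.
  by exists (((l2norm f)^-1)%:C%C *: f) => //=; rewrite l2normZ nv mulVf.
by rewrite linZ// l2normZ nv mulrC ler_pdivrMr.
Qed.

Lemma opnorm_le A (M : R) : 0 <= M -> (forall f, l2norm (A f) <= M * l2norm f) ->
  opnorm A <= M.
Proof.
move=> M0 AM; apply: ge_sup.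
  by exists (l2norm (A 0)), 0 => //=; rewrite l2norm0.
by move=> _ [f /= f1 <-]; apply: le_trans (AM f) _; exact: ler_piMr.
Qed.

Lemma opnorm_ge0 A : bounded_op A -> 0 <= opnorm A.
Proof.
move=> bA; have [[t _]|noT] := pselect (exists t : T, True).
  have := opnorm_ub (chi t) bA; rewrite l2norm_chi mulr1.
  exact: le_trans (l2norm_ge0 _).
have n0 f : l2norm (A f) = 0.
  by rewrite (_ : A f = 0) ?l2norm0//; apply: ell2P => t; case: noT; exists t.
have -> : opnorm A = sup [set 0].
  congr sup; apply/seteqP; split => [_ [f _ <-]|_ ->] /=; first exact: n0.
  by exists 0; rewrite /= ?n0 ?l2norm0.
by rewrite sup1.
Qed.

Lemma bounded_id : bounded_op (idfun : oper).
Proof. by apply: (@bounded_opI _ 1) => // f; rewrite mul1r. Qed.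

Lemma bounded_comp A B : bounded_op A -> bounded_op B -> bounded_op (A \o B).
Proof.
move=> bA bB; apply: (@bounded_opI _ (opnorm A * opnorm B)).
  by move=> a f g /=; rewrite (bB.1 a) (bA.1 a).
move=> f /=; rewrite (le_trans (opnorm_ub _ bA))// -mulrA ler_wpM2l//.
  exact: opnorm_ge0.
exact: opnorm_ub.
Qed.

Lemma opD A B f : (A + B) f = A f + B f. Proof. by []. Qed.
Lemma opN A f : (- A) f = - A f. Proof. by []. Qed.
Lemma opB A B f : (A - B) f = A f - B f. Proof. by []. Qed.
Lemma op0 f : (0 : oper) f = 0. Proof. by []. Qed.
Lemma op_sum (I : Type) (s : seq I) (P : pred I) (F : I -> oper) f :
  (\sum_(i <- s | P i) F i) f = \sum_(i <- s | P i) F i f.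
Proof. by elim/big_rec2: _ => // i y x _ <-. Qed.

Lemma bounded_add A B : bounded_op A -> bounded_op B -> bounded_op (A + B).
Proof.
move=> bA bB; apply: (@bounded_opI _ (opnorm A + opnorm B)).
  by move=> a f g; rewrite !opD (bB.1 a) (bA.1 a) scalerDr addrACA.
move=> f; rewrite opD (le_trans (l2normD _ _))// mulrDl lerD//; exact: opnorm_ub.
Qed.

Lemma bounded_opp A : bounded_op A -> bounded_op (- A).
Proof.
move=> bA; apply: (@bounded_opI _ (opnorm A)).
  by move=> a f g; rewrite !opN (bA.1 a) scalerN opprD.
by move=> f; rewrite opN l2normN opnorm_ub.
Qed.

Lemma bounded_sub A B : bounded_op A -> bounded_op B -> bounded_op (A - B).
Proof. by move=> bA bB; apply: bounded_add => //; exact: bounded_opp. Qed.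

Lemma bounded_0 : bounded_op (0 : oper).
Proof.
apply: (@bounded_opI _ 0) => [a f g|f]; last by rewrite mul0r op0 l2norm0.
by rewrite !op0 scaler0 addr0.
Qed.

Lemma bounded_sum (I : Type) (s : seq I) (P : pred I) (F : I -> oper) :
  (forall i, bounded_op (F i)) -> bounded_op (\sum_(i <- s | P i) F i).
Proof.
move=> bF; elim/big_ind: _ => //; [exact: bounded_0|exact: bounded_add].
Qed.

Lemma bounded_iter A n : bounded_op A -> bounded_op (iter n A).
Proof.
by move=> bA; elim: n => [|n IHn]; [exact: bounded_id|exact: bounded_comp].
Qed.

(** By density of the finite combinations, one coordinate of the difference at a
    time. *)
Lemma op_entryP A B : bounded_op A -> bounded_op B ->
  (forall t u, A (chi t) u = B (chi t) u) -> A = B.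
Proof.
move=> bA bB AB; apply/funext => f; apply: ell2P => u; apply/eqP.
rewrite -subr_eq0 -ell2B -opB; apply/eqP.
have bD := bounded_sub bA bB.
apply: (@functional_eq0 (fun f => (A - B) f u) (opnorm (A - B))) => [g h|a g|g|t].
- by rewrite linD//; case: bD.
- by rewrite linZ//; case: bD.
- by rewrite (le_trans (normc_le_l2norm _ _))// opnorm_ub.
- by rewrite opB ell2B AB subrr.
Qed.

(** The finite sections of the matrix being uniformly bounded is all that is
    needed: each row is then in l2, the operator is defined row by row as an
    inner product, and the bound passes from finite combinations to all
    vectors. Every operator below that is not given by a formula is obtained
    here. *)
Lemma matrix_op (A : T -> T -> C) (M : R) : 0 <= M ->
  (forall (s r : seq T) (a : T -> C), uniq s -> uniq r ->
     \sum_(u <- r) normc (\sum_(t <- s) A u t * a t) ^+ 2 <=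
     M ^+ 2 * \sum_(t <- s) normc (a t) ^+ 2) ->
  exists X : oper, [/\ bounded_op X, forall f, l2norm (X f) <= M * l2norm f &
    forall t u, X (chi t) u = A u t].
Proof.
move=> M0 AM.
have row2 u : (fun t => (A u t)^*) \in @l2 R T.
  apply: (@in_l2 _ _ _ (M ^+ 2)) => s us.
  (* Testing on the conjugate of the row itself bounds the norm of the row. *)
  have := AM s [:: u] (fun t => (A u t)^*) us isT; rewrite big_seq1.
  under eq_bigr => t _ do rewrite mulc_conj.
  rewrite -rmorph_sum /= expr0n /= addr0 sqrtr_sqr ger0_norm; last first.
    by rewrite sumr_ge0// => t _; exact: sqr_ge0.
  under [X in _ <= _ * X -> _]eq_bigr => t _ do rewrite normc_conj.
  under [X in _ -> X <= _]eq_bigr => t _ do rewrite normc_conj.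
  set S := \sum_(t <- s) _ => hS.
  have [->|S0] := eqVneq S 0; first exact: sqr_ge0.
  have Sp : 0 < S by rewrite lt_def S0 sumr_ge0// => t _; exact: sqr_ge0.
  by rewrite -(ler_pM2r Sp) -expr2.
pose row u : ell2 := Ell2 (row2 u).
have rowE u t : row u t = (A u t)^* by [].
pose G r f := fin_comb r (fun u => inner f (row u)).
have Gfin r s f : uniq r -> uniq s -> l2norm (G r (fin_comb s f)) <= M * l2norm f.
  move=> ur us.
  rewrite -ler_sqr ?nnegrE ?mulr_ge0 ?l2norm_ge0// fin_comb_norm//.
  rewrite exprMn (le_trans _ (ler_wpM2l (sqr_ge0 M) (l2norm_bound f us)))//.
  rewrite (le_trans _ (AM s r f us ur))// ler_sum// => u _.
  rewrite inner_suml (eq_bigr (fun t => A u t * f t))// => t _.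
  by rewrite innerZl inner_chil rowE conjCK mulrC.
have Gbnd r f : uniq r -> l2norm (G r f) <= M * l2norm f.
  move=> ur; apply/ler_addgt0Pr => eps e0.
  pose K := \sum_(u <- r) l2norm (row u) + 1.
  have K0 : 0 < K.
    by rewrite ltr_wpDl// sumr_ge0// => u _; exact: l2norm_ge0.
  have [s us hs] := fin_comb_approx f (divr_gt0 e0 K0).
  have -> : G r f = G r (fin_comb s f) + G r (f - fin_comb s f).
    apply: ell2P => u; rewrite ell2D !fin_combE//; case: ifP => _.
      by rewrite -innerDl addrC subrK.
    by rewrite addr0.
  apply: le_trans (l2normD _ _) (lerD (Gfin _ _ _ ur us) _).
  have -> : eps = K * (eps / K) by rewrite mulrC divfK ?gt_eqF.
  apply: le_trans (l2norm_sum _ _) _.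
  apply: (@le_trans _ _ (\sum_(u <- r) l2norm (row u) * (eps / K))).
    apply: ler_sum => u _; rewrite l2normZ l2norm_chi mulr1.
    apply: le_trans (cauchy_schwarz _ _) _.
    by rewrite mulrC ler_wpM2l// l2norm_ge0.
  by rewrite -mulr_suml ler_wpM2r ?ltW ?divr_gt0// ltrDl.
have X2 f : (fun u => inner f (row u)) \in @l2 R T.
  apply: (@in_l2 _ _ _ ((M * l2norm f) ^+ 2)) => r ur.
  rewrite -(fin_comb_norm (fun u => inner f (row u)) ur).
  by rewrite ler_sqr ?nnegrE ?mulr_ge0 ?l2norm_ge0// Gbnd.
pose X : oper := fun f => Ell2 (X2 f).
have XE f u : X f u = inner f (row u) by [].
have XM f : l2norm (X f) <= M * l2norm f.
  apply: l2norm_le; first by rewrite mulr_ge0 ?l2norm_ge0.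
  move=> r ur; under eq_bigr do rewrite XE.
  rewrite -(fin_comb_norm (fun u => inner f (row u)) ur).
  by rewrite ler_sqr ?nnegrE ?mulr_ge0 ?l2norm_ge0// Gbnd.
exists X; split => //.
- apply: (bounded_opI _ XM) => a f g; apply: ell2P => u.
  by rewrite ell2D ell2Z !XE innerDl innerZl.
- by move=> t u; rewrite XE inner_chil rowE conjCK.
Qed.

(** The conjugate transpose of the matrix of [A] has bounded sections: with
    [b] the image of a finite combination, [l2norm b ^+ 2] is an inner product
    of that combination with the image of [b] under [A]. *)
Lemma adjoint_exists A : bounded_op A -> exists2 B, bounded_op B &
  forall f g, inner (A f) g = inner f (B g).
Proof.
move=> bA; have lA := bA.1.
have [|s r a us ur|X [bX XM XE]] :=
    @matrix_op (fun t u => (A (chi t) u)^*) (opnorm A); first exact: opnorm_ge0.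
  pose b t := \sum_(u <- s) (A (chi t) u)^* * a u.
  have bE t : b t = inner (fin_comb s a) (A (chi t)).
    rewrite inner_suml; apply: eq_bigr => u _.
    by rewrite innerZl inner_chil mulrC.
  rewrite -/(b _) -(fin_comb_norm a us).
  rewrite -(fin_comb_norm b ur) -exprMn.
  rewrite ler_sqr ?nnegrE ?mulr_ge0 ?l2norm_ge0 ?opnorm_ge0//.
  have [->|b0] := eqVneq (l2norm (fin_comb r b)) 0.
    by rewrite mulr_ge0 ?l2norm_ge0 ?opnorm_ge0.
  have bp : 0 < l2norm (fin_comb r b) by rewrite lt_def b0 l2norm_ge0.
  rewrite -(ler_pM2r bp) -expr2 fin_comb_norm//.
  have eqb : inner (fin_comb s a) (A (fin_comb r b)) =
     (\sum_(t <- r) normc (b t) ^+ 2)%:C%C.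
    rewrite /fin_comb lin_sum// inner_sumr rmorph_sum; apply: eq_bigr => t _.
    by rewrite linZ// innerZr -bE mulrC mulc_conj.
  have := cauchy_schwarz (fin_comb s a) (A (fin_comb r b)).
  rewrite eqb [normc _]/= expr0n /= addr0 sqrtr_sqr ger0_norm; last first.
    by rewrite sumr_ge0// => t _; exact: sqr_ge0.
  move=> /le_trans; apply.
  by rewrite [leRHS]mulrAC mulrC ler_wpM2r ?l2norm_ge0// opnorm_ub.
have lX := bX.1.
have XA f u : inner (A f) (chi u) = inner f (X (chi u)).
  apply/eqP; rewrite -subr_eq0; apply/eqP; move: f.
  apply: (@functional_eq0 _ (opnorm A + l2norm (X (chi u)))) => [f g|a f|f|t].
  - by rewrite linD// !innerDl opprD addrACA.
  - by rewrite linZ// !innerZl mulrBr.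
  - rewrite (le_trans (le_normcD _ _))// normcN mulrDl lerD//.
      rewrite (le_trans (cauchy_schwarz _ _))// l2norm_chi mulr1 opnorm_ub//.
    by rewrite (le_trans (cauchy_schwarz _ _))// mulrC.
  - by rewrite inner_chir inner_chil XE conjCK subrr.
exists X => // f g; rewrite inner_conj [RHS]inner_conj; congr (_ ^*)%C.
apply/eqP; rewrite -subr_eq0; apply/eqP; move: g.
apply: (@functional_eq0 _ (l2norm (A f) + opnorm X * l2norm f)) => [g h|a g|g|t].
- by rewrite linD// !innerDl opprD addrACA.
- by rewrite linZ// !innerZl mulrBr.
- rewrite (le_trans (le_normcD _ _))// normcN mulrDl lerD//.
    by rewrite (le_trans (cauchy_schwarz _ _))// mulrC.
  rewrite (le_trans (cauchy_schwarz _ _))// mulrAC ler_wpM2r ?l2norm_ge0//.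
  exact: opnorm_ub.
- by rewrite inner_conj XA -inner_conj subrr.
Qed.

Lemma adjointP A : bounded_op A ->
  bounded_op (adjoint A) /\ forall f g, inner (A f) g = inner f (adjoint A g).
Proof.
move=> /adjoint_exists[B bB AB].
have : [set B | bounded_op B /\ forall f g, inner (A f) g = inner f (B g)] B.
  by [].
by move/(xgetI 0).
Qed.

Lemma bounded_adjoint A : bounded_op A -> bounded_op (adjoint A).
Proof. by case/adjointP. Qed.

Lemma inner_adjr A f g : bounded_op A -> inner f (adjoint A g) = inner (A f) g.
Proof. by case/adjointP. Qed.

Lemma inner_adjl A f g : bounded_op A -> inner (adjoint A f) g = inner f (A g).
Proof. by move=> bA; rewrite inner_conj inner_adjr// -inner_conj. Qed.

Lemma adjoint_entry A t u : bounded_op A ->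
  adjoint A (chi u) t = (A (chi t) u)^*.
Proof. by move=> bA; rewrite -inner_chir inner_adjl// inner_chil. Qed.

(** With [inner_disjoint], this derives the support of [A f] from those of [f]
    and of a column of the adjoint. *)
Lemma op_valE A f u : bounded_op A -> A f u = inner f (adjoint A (chi u)).
Proof. by move=> bA; rewrite inner_adjr// inner_chir. Qed.

Lemma adjointK A : bounded_op A -> adjoint (adjoint A) = A.
Proof.
move=> bA; apply: op_entryP => //; first by do 2!apply: bounded_adjoint.
by move=> t u; rewrite !adjoint_entry ?conjCK//; exact: bounded_adjoint.
Qed.

Lemma adjoint_comp A B : bounded_op A -> bounded_op B ->
  adjoint (A \o B) = adjoint B \o adjoint A.
Proof.
move=> bA bB; have bAB := bounded_comp bA bB.
apply: op_entryP; [exact: bounded_adjoint| |].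
  by apply: bounded_comp; exact: bounded_adjoint.
by move=> t u; rewrite -!inner_chir /= !inner_adjl.
Qed.

Lemma adjoint_id : adjoint idfun = idfun :> oper.
Proof.
apply: op_entryP; [exact/bounded_adjoint/bounded_id|exact: bounded_id|].
by move=> t u; rewrite -!inner_chir inner_adjl//; exact: bounded_id.
Qed.

Lemma adjoint_sub A B : bounded_op A -> bounded_op B ->
  adjoint (A - B) = adjoint A - adjoint B.
Proof.
move=> bA bB; have bAB := bounded_sub bA bB.
apply: op_entryP; first exact: bounded_adjoint.
  by apply: bounded_sub; exact: bounded_adjoint.
move=> t u; rewrite opB ell2B !adjoint_entry// opB ell2B.
by rewrite rmorphB.
Qed.

Lemma opnorm_adjoint A : bounded_op A -> opnorm (adjoint A) <= opnorm A.
Proof.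
move=> bA; apply: opnorm_le; first exact: opnorm_ge0.
move=> f; have [->|f0] := eqVneq (l2norm (adjoint A f)) 0.
  by rewrite mulr_ge0 ?l2norm_ge0 ?opnorm_ge0.
have fp : 0 < l2norm (adjoint A f) by rewrite lt_def f0 l2norm_ge0.
rewrite -(ler_pM2r fp) -expr2 l2norm_sqrE inner_adjl//.
apply: le_trans (ler_norm _) _.
apply: le_trans (Re_le_normc _) _; apply: le_trans (cauchy_schwarz _ _) _.
by rewrite [leRHS]mulrAC mulrC ler_wpM2r ?l2norm_ge0// opnorm_ub.
Qed.

Lemma opnorm_comp A B : bounded_op A -> bounded_op B ->
  opnorm (A \o B) <= opnorm A * opnorm B.
Proof.
move=> bA bB; apply: opnorm_le; first by rewrite mulr_ge0 ?opnorm_ge0.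
move=> f /=; rewrite (le_trans (opnorm_ub _ bA))// -mulrA ler_wpM2l ?opnorm_ge0//.
exact: opnorm_ub.
Qed.

Lemma opnorm_le0 A : bounded_op A -> opnorm A <= 0 -> A = 0.
Proof.
move=> bA A0; apply/funext => f; apply: l2norm0_eq0; apply/eqP.
rewrite eq_le l2norm_ge0 andbT (le_trans (opnorm_ub f bA))//.
by rewrite mulr_le0_ge0 ?l2norm_ge0.
Qed.

Lemma op_invE A B : bounded_op A -> bounded_op B -> A \o B = idfun -> B \o A = idfun ->
  op_inv A = B.
Proof.
move=> bA bB AB BA; have : [set B | [/\ bounded_op B, A \o B = idfun & B \o A = idfun]] B by [].
move=> /(xgetI 0) [b' AB' B'A]; rewrite -/(op_inv A) in b' AB' B'A.
apply/funext => f; have /(congr1 (@^~ (op_inv A f))) /= := BA.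
by have /(congr1 (@^~ f)) /= -> := AB'.
Qed.

Lemma op_seriesE (u : nat -> oper) A : (forall n, bounded_op (u n)) ->
  bounded_op A ->
  (fun n => opnorm (\sum_(0 <= k < n) u k - A)) @ \oo --> (0 : R) ->
  op_series u = A.
Proof.
move=> bu bA uA.
have : [set A | bounded_op A /\
    (fun n => opnorm (\sum_(0 <= k < n) u k - A)) @ \oo --> (0 : R)] A by [].
move=> /(xgetI 0); rewrite -/(op_series u); set B := op_series u => -[bB uB].
suff /subr0_eq : B - A = 0 by [].
apply: opnorm_le0; first exact: bounded_sub.
have lim0 := cvgD uB uA; rewrite addr0 in lim0.
apply: (@cvgr_to_ge _ _ _ R _ _ _ (lim0 _)); apply: nearW => n /=.
have bS : bounded_op (\sum_(0 <= k < n) u k) by exact: bounded_sum.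
apply: opnorm_le => [|f]; first by rewrite addr_ge0 ?opnorm_ge0//; exact: bounded_sub.
rewrite opB (le_trans (l2norm_triangle ((\sum_(0 <= k < n) u k) f) _ _))//.
rewrite l2normB -!opB mulrDl lerD//; apply: opnorm_ub; exact: bounded_sub.
Qed.

(** The form in which the series of the theorem converge: the limit is known
    beforehand and the tails are geometric. *)
Lemma op_series_geometric (u : nat -> oper) A (K r : R) :
  (forall n, bounded_op (u n)) -> bounded_op A -> 0 <= r < 1 ->
  (forall n, opnorm (\sum_(0 <= k < n) u k - A) <= K * r ^+ n) ->
  op_series u = A.
Proof.
move=> bu bA /andP[r0 r1] uA; apply: op_seriesE => //.
have Kr : (fun n => K * r ^+ n) @ \oo --> (0 : R).
  rewrite -[X in _ --> X](mulr0 K); apply: cvgMr; apply: cvg_expr.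
  by rewrite ger0_norm.
apply: squeeze_cvgr _ (cvg_cst (0 : R)) Kr; apply: nearW => n.
by rewrite uA opnorm_ge0//; apply: bounded_sub => //; exact: bounded_sum.
Qed.

End operators.
(** * Operators graded by a level function *)

Section graded.
Variables (R : realType) (T : choiceType) (lev : T -> int).
Local Notation normc := (@ComplexField.Normc.normc R).
Local Notation ell2 := (ell2 R T).
Local Notation oper := (oper R T).
Local Notation chi := (chi R).
Implicit Types (f g h : ell2) (A B D F G N S : oper) (m n : int).

(** [low 0] is causality and [low 1] strict causality. *)
Definition low n A := forall t u, lev u < lev t + n -> A (chi t) u = 0.

Definition homog n A := forall t u, lev u != lev t + n -> A (chi t) u = 0.

Definition supp_ge m f := forall t, lev t < m -> f t = 0.

Definition supp_at m f := forall t, lev t != m -> f t = 0.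

Lemma supp_at_chi t : supp_at (lev t) (chi t).
Proof.
by move=> u ut; rewrite chiE; case: (eqVneq u t) ut => [->|//]; rewrite eqxx.
Qed.

Lemma supp_ge_chi t : supp_ge (lev t) (chi t).
Proof.
by move=> u ut; rewrite chiE; case: (eqVneq u t) ut => [->|//]; rewrite ltxx.
Qed.

Lemma supp_at_ge m f : supp_at m f -> supp_ge m f.
Proof. by move=> fm t tm; apply: fm; rewrite lt_eqF. Qed.

Lemma low_supp n m A f : bounded_op A -> low n A -> supp_ge m f ->
  supp_ge (m + n) (A f).
Proof.
move=> bA lA fm u um; rewrite op_valE//; apply: inner_disjoint => t.
rewrite adjoint_entry//; have [tm|mt] := ltP (lev t) m; first by left; exact: fm.
by right; rewrite lA ?conjC0//; lia.
Qed.

Lemma homog_supp n m A f : bounded_op A -> homog n A -> supp_at m f ->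
  supp_at (m + n) (A f).
Proof.
move=> bA lA fm u um; rewrite op_valE//; apply: inner_disjoint => t.
rewrite adjoint_entry//; have [tm|mt] := eqVneq (lev t) m; last by left; exact: fm.
by right; rewrite lA ?conjC0// tm.
Qed.

(** A homogeneous operator reads, at a node, only the values of its argument
    on the one level it transports there. *)
Lemma homog_local n A f g u : bounded_op A -> homog n A ->
  (forall t, lev t + n = lev u -> f t = g t) -> A f u = A g u.
Proof.
move=> bA hA fg; apply/eqP; rewrite -subr_eq0 -ell2B -linB; last by case: bA.
apply/eqP; rewrite op_valE//; apply: inner_disjoint => t.
rewrite adjoint_entry//; have [tn|tn] := eqVneq (lev u) (lev t + n).
  by left; rewrite ell2B fg ?subrr.
by right; rewrite hA ?conjC0.
Qed.

Lemma homog_low n A : homog n A -> low n A.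
Proof. by move=> hA t u tu; apply: hA; rewrite lt_eqF. Qed.

Lemma low_comp m n A B : bounded_op A -> bounded_op B -> low m A -> low n B ->
  low (n + m) (A \o B).
Proof.
move=> bA bB lA lB t u tu; apply: (low_supp bA lA (m := lev t + n)) => [v vt|].
  exact: lB.
by rewrite -addrA.
Qed.

Lemma homog_comp m n A B : bounded_op A -> bounded_op B ->
  homog m A -> homog n B -> homog (n + m) (A \o B).
Proof.
move=> bA bB lA lB t u tu; apply: (homog_supp bA lA (m := lev t + n)) => [v vt|].
  exact: lB.
by rewrite -addrA.
Qed.

Lemma homog_adjoint n A : bounded_op A -> homog n A -> homog (- n) (adjoint A).
Proof.
by move=> bA hA t u tu; rewrite adjoint_entry// hA ?conjC0//; lia.
Qed.

Lemma homog_id : homog 0 idfun.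
Proof.
move=> t u; rewrite addr0 => tu; rewrite [LHS]chiE.
by case: (eqVneq u t) tu => [->|//]; rewrite eqxx.
Qed.

Lemma homog_sub n A B : homog n A -> homog n B -> homog n (A - B).
Proof. by move=> hA hB t u tu; rewrite opB ell2B hA// hB// subrr. Qed.

Lemma low_sub n A B : low n A -> low n B -> low n (A - B).
Proof. by move=> hA hB t u tu; rewrite opB ell2B hA// hB// subrr. Qed.

Lemma homog_iter (k : nat) n A : bounded_op A -> homog n A ->
  homog (n *+ k) (iter k A).
Proof.
move=> bA hA; elim: k => [|k IHk]; first exact: homog_id.
by rewrite mulrSr; apply: homog_comp => //; exact: bounded_iter.
Qed.

(** Keeping only the matrix entries that match two labellings of the nodes
    does not increase the norm: on the finite sections the labels split both
    sides into orthogonal pieces. *)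
Lemma mask_exists (I : eqType) (k l : T -> I) A : bounded_op A -> exists X : oper,
  [/\ bounded_op X, forall f, l2norm (X f) <= opnorm A * l2norm f &
    forall t u, X (chi t) u = if k t == l u then A (chi t) u else 0].
Proof.
move=> bA; apply: matrix_op (opnorm_ge0 bA) _ => s r a us ur.
pose ks := undup (map l r).
have exch (F : T -> R) (v : seq T) (p : T -> I) :
    \sum_(c <- ks) \sum_(u <- v | p u == c) F u =
    \sum_(u <- v) (if p u \in ks then F u else 0).
  rewrite (exchange_big_dep predT)//=; apply: eq_bigr => u _.
  rewrite big_const_seq (eq_count (a2 := pred1 (p u))); last first.
    by move=> c; rewrite /= eq_sym.
  by rewrite count_uniq_mem ?undup_uniq//; case: (_ \in _); rewrite //= addr0.
apply: (@le_trans _ _ (\sum_(c <- ks) \sum_(u <- r | l u == c)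
    normc (\sum_(t <- s | k t == c) A (chi t) u * a t) ^+ 2)).
  rewrite (eq_bigr (fun c => \sum_(u <- r | l u == c)
    normc (\sum_(t <- s | k t == l u) A (chi t) u * a t) ^+ 2)); last first.
    by move=> c _; apply: eq_bigr => u /eqP <-.
  rewrite exch big_seq [leRHS]big_seq; apply: ler_sum => u ur'.
  rewrite mem_undup map_f// [X in _ <= normc X ^+ 2]big_mkcond/=.
  rewrite (eq_bigr (fun t => if k t == l u then A (chi t) u * a t else 0))//.
  by move=> t _; case: eqP => // _; rewrite mul0r.
apply: (@le_trans _ _ (\sum_(c <- ks) (opnorm A ^+ 2 *
    \sum_(t <- s | k t == c) normc (a t) ^+ 2))).
  apply: ler_sum => c _; rewrite -[leLHS]big_filter -[X in _ <= _ * X]big_filter.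
  have usc : uniq [seq t <- s | k t == c] by exact: filter_uniq.
  have urc : uniq [seq u <- r | l u == c] by exact: filter_uniq.
  rewrite -(fin_comb_norm a usc) -exprMn.
  apply: (@le_trans _ _ (l2norm (A (fin_comb [seq t <- s | k t == c] a)) ^+ 2)).
    apply: le_trans (l2norm_bound _ urc); apply: ler_sum => u _.
    rewrite /fin_comb lin_sum; last by case: bA.
    rewrite ell2_sum big_filter [in leRHS](eq_bigr (fun t => A (chi t) u * a t))// => t _.
    by rewrite linZ ?ell2Z 1?mulrC//; case: bA.
  by rewrite ler_sqr ?nnegrE ?mulr_ge0 ?opnorm_ge0 ?l2norm_ge0// opnorm_ub.
rewrite -mulr_sumr exch ler_wpM2l ?sqr_ge0//; apply: ler_sum => t _.
by case: ifP => // _; exact: sqr_ge0.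
Qed.

Definition degree_part n A : oper := xget 0 [set X | [/\ bounded_op X,
  forall f, l2norm (X f) <= opnorm A * l2norm f &
  forall t u, X (chi t) u = if lev t + n == lev u then A (chi t) u else 0]].

Lemma degree_partP n A : bounded_op A -> [/\ bounded_op (degree_part n A),
  forall f, l2norm (degree_part n A f) <= opnorm A * l2norm f &
  forall t u, degree_part n A (chi t) u = if lev t + n == lev u then A (chi t) u else 0].
Proof.
move=> bA; have [X XP] := mask_exists (fun t => lev t + n) lev bA.
exact: (@xgetI _ (0 : oper) [set X | [/\ bounded_op X,
  forall f, l2norm (X f) <= opnorm A * l2norm f &
  forall t u, X (chi t) u = if lev t + n == lev u then A (chi t) u else 0]] X XP).
Qed.

Lemma bounded_degree_part n A : bounded_op A -> bounded_op (degree_part n A).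
Proof. by case/(degree_partP n). Qed.

Lemma opnorm_degree_part n A : bounded_op A -> opnorm (degree_part n A) <= opnorm A.
Proof. by move=> bA; have [_ + _] := degree_partP n bA; apply/opnorm_le/opnorm_ge0. Qed.

Lemma degree_partE n A t u : bounded_op A ->
  degree_part n A (chi t) u = if lev t + n == lev u then A (chi t) u else 0.
Proof. by case/(degree_partP n). Qed.

Lemma homog_degree_part n A : bounded_op A -> homog n (degree_part n A).
Proof. by move=> bA t u tu; rewrite degree_partE// eq_sym (negPf tu). Qed.

Lemma degree_part_val n m A f u : bounded_op A -> supp_at m f ->
  degree_part n A f u = if m + n == lev u then A f u else 0.
Proof.
move=> bA fm; have bX := bounded_degree_part n bA.
case: ifPn => mu.
  apply/eqP; rewrite -subr_eq0 -ell2B -opB; apply/eqP.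
  have bD := bounded_sub bX bA.
  rewrite op_valE//; apply: inner_disjoint => t.
  have [tm|tm] := eqVneq (lev t) m; last by left; exact: fm.
  by right; rewrite adjoint_entry// opB ell2B degree_partE// tm mu subrr conjC0.
by rewrite (homog_supp bX (homog_degree_part bA) fm)// eq_sym.
Qed.

Lemma degree_partB n A B : bounded_op A -> bounded_op B ->
  degree_part n (A - B) = degree_part n A - degree_part n B.
Proof.
move=> bA bB; apply: op_entryP; first exact/bounded_degree_part/bounded_sub.
  by apply: bounded_sub; exact: bounded_degree_part.
move=> t u; rewrite opB ell2B !degree_partE//; last exact: bounded_sub.
by rewrite opB ell2B; case: ifP; rewrite ?subrr.
Qed.

Lemma degree_part0 n : degree_part n 0 = 0.
Proof.
have b0 := @bounded_0 R T; apply: op_entryP => //; first exact: bounded_degree_part.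
by move=> t u; rewrite degree_partE// op0 ell20; case: ifP.
Qed.

Lemma degree_partD n A B : bounded_op A -> bounded_op B ->
  degree_part n (A + B) = degree_part n A + degree_part n B.
Proof.
move=> bA bB; have bAB := bounded_add bA bB.
have -> : degree_part n A = degree_part n ((A + B) - B) by rewrite addrK.
by rewrite degree_partB// subrK.
Qed.

Lemma degree_part_sum n (I : Type) (s : seq I) (F : I -> oper) :
  (forall i, bounded_op (F i)) ->
  degree_part n (\sum_(i <- s) F i) = \sum_(i <- s) degree_part n (F i).
Proof.
move=> bF; elim: s => [|i s IHs]; first by rewrite !big_nil degree_part0.
by rewrite !big_cons degree_partD ?IHs//; exact: bounded_sum.
Qed.

Lemma degree_part_low n m A : bounded_op A -> low m A -> n < m -> degree_part n A = 0.
Proof.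
move=> bA lA nm; apply: op_entryP; [exact: bounded_degree_part|exact: bounded_0|].
by move=> t u; rewrite degree_partE// op0 ell20; case: eqP => // tu; apply: lA; lia.
Qed.

(** A homogeneous factor can be moved through the truncation to one degree;
    this and the next lemma identify partial sums with diagonals of products. *)
Lemma comp_homog_degree_part m n A B : bounded_op A -> bounded_op B -> homog m B ->
  B \o degree_part n A = degree_part (n + m) (B \o A).
Proof.
move=> bA bB hB; have bBA := bounded_comp bB bA; have bX := bounded_degree_part n bA.
apply: op_entryP; [exact: bounded_comp|exact: bounded_degree_part|] => t u.
rewrite degree_partE//; case: eqP => tu /=.
  by apply: (homog_local bB hB) => v vu; rewrite degree_partE//; case: eqP => //; lia.
apply: (homog_supp bB hB (m := lev t + n)); last by apply/eqP; lia.
by move=> v vt; rewrite degree_partE// eq_sym (negPf vt).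
Qed.

Lemma comp_degree_part_homog m n A B : bounded_op A -> bounded_op B -> homog m B ->
  degree_part n A \o B = degree_part (m + n) (A \o B).
Proof.
move=> bA bB hB; have bAB := bounded_comp bA bB; have bX := bounded_degree_part n bA.
apply: op_entryP; [exact: bounded_comp|exact: bounded_degree_part|] => t u.
have hs : supp_at (lev t + m) (B (chi t)) by move=> v; exact: hB.
by rewrite degree_partE// /= (degree_part_val _ _ _ hs)// addrA.
Qed.

End graded.
(** * Inverting one minus an operator of degree minus one *)

Lemma geometric_le (R : realType) (r : R) n : 0 <= r < 1 ->
  \sum_(0 <= k < n) r ^+ k <= (1 - r)^-1.
Proof.
move=> /andP[r0 r1]; have r1' : 0 < 1 - r by rewrite subr_gt0.
have E : (1 - r) * \sum_(0 <= k < n) r ^+ k = 1 - r ^+ n.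
  elim: n => [|n IHn]; first by rewrite big_geq// mulr0 subrr.
  by rewrite big_nat_recr//= mulrDr IHn exprS; ring.
rewrite -(ler_pM2l r1') E mulfV ?gt_eqF// gerBl; exact: exprn_ge0.
Qed.

Section neumann.
Variables (R : realType) (T : choiceType) (lev : T -> int).
Local Notation C := (complex R).
Local Notation ell2 := (ell2 R T).
Local Notation oper := (oper R T).
Local Notation chi := (chi R).
Local Notation homog := (homog lev).
Local Notation supp_at := (supp_at lev).
Implicit Types (f g h : ell2) (A B D F G N S : oper).

Definition geometric_op B := [/\ bounded_op B, homog (-1) B &
  exists K r : R, [/\ 0 <= K, 0 <= r < 1 &
    forall n, opnorm (iter n B) <= K * r ^+ n]].

Lemma homog_geom B k : geometric_op B -> homog (- k%:Z) (iter k B).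
Proof.
by move=> [bB hB _]; have := homog_iter (k := k) bB hB; rewrite mulNrn natz.
Qed.

(** Powers of [B] have different degrees, so each matrix entry of their sum
    is an entry of a single power; the finite sections of the limit are those
    of long partial sums. *)
Definition neumann_entry B t u : C :=
  if lev u <= lev t then iter `|lev t - lev u|%N B (chi t) u else 0.

Lemma sum_iter_entry B (L : nat) t u : geometric_op B ->
  (`|lev t - lev u|%N < L)%N ->
  (\sum_(0 <= k < L) iter k B) (chi t) u = neumann_entry B t u.
Proof.
move=> gB tuL; rewrite op_sum ell2_sum /neumann_entry; case: ifPn => tu.
  rewrite big_mkord (bigD1 (Ordinal tuL))//= big1 ?addr0// => k kt.
  apply: (homog_geom gB); apply: contraNneq kt => kE; apply/eqP/val_inj => /=.
  by lia.
by rewrite big1 // => k _; apply: (homog_geom gB); lia.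
Qed.

Lemma neumann_exists B : geometric_op B ->
  exists2 N, bounded_op N & forall t u, N (chi t) u = neumann_entry B t u.
Proof.
move=> gB; have [bB hB [K [r [K0 r01 Kr]]]] := gB.
have r1 : 0 < 1 - r by case/andP: r01 => _; rewrite subr_gt0.
have M0 : 0 <= K * (1 - r)^-1 by rewrite mulr_ge0// invr_ge0 ltW.
have [|X [bX _ XE]] := @matrix_op R T (fun u t => neumann_entry B t u) _ M0.
  move=> s v a us uv.
  pose L := (\max_(t <- s) \max_(u <- v) `|lev t - lev u|%N).+1.
  have Lb t u : t \in s -> u \in v -> (`|lev t - lev u|%N < L)%N.
    move=> ts uv'; rewrite ltnS.
    have := @leq_bigmax_seq _ s xpredT
      (fun t => \max_(u <- v) `|lev t - lev u|%N) t ts isT.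
    apply: leq_trans.
    exact: (@leq_bigmax_seq _ v xpredT (fun u => `|lev t - lev u|%N) u uv' isT).
  pose P : oper := \sum_(0 <= k < L) iter k B.
  have bP : bounded_op P by apply: bounded_sum => k; exact: bounded_iter.
  have Pn f : l2norm (P f) <= K * (1 - r)^-1 * l2norm f.
    rewrite /P op_sum (le_trans (l2norm_sum _ _))//.
    apply: (@le_trans _ _ (\sum_(0 <= k < L) K * r ^+ k * l2norm f)).
      apply: ler_sum => k _; rewrite (le_trans (opnorm_ub _ (bounded_iter k bB)))//.
      by rewrite ler_wpM2r ?l2norm_ge0.
    rewrite -mulr_suml -mulr_sumr ler_wpM2r ?l2norm_ge0// ler_wpM2l//.
    exact: geometric_le.
  rewrite -(fin_comb_norm a us) -exprMn.
  apply: (@le_trans _ _ (l2norm (P (fin_comb s a)) ^+ 2)).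
    apply: le_trans (l2norm_bound _ uv).
    rewrite big_seq [leRHS]big_seq; apply: ler_sum => u uv'.
    rewrite /fin_comb lin_sum ?ell2_sum; last by case: bP.
    rewrite big_seq [in leRHS]big_seq.
    rewrite (eq_bigr (fun t => P (a t *: chi t) u))// => t ts.
    by rewrite linZ ?ell2Z ?sum_iter_entry ?Lb// 1?mulrC//; case: bP.
  rewrite lerXn2r ?nnegrE ?l2norm_ge0 ?Pn//.
  by apply: mulr_ge0 M0 _; exact: l2norm_ge0.
by exists X.
Qed.

Definition neumann B : oper := op_inv (idfun - B).

Lemma neumann_spec B : geometric_op B -> [/\ bounded_op (neumann B),
  forall t u, neumann B (chi t) u = neumann_entry B t u,
  (idfun - B) \o neumann B = idfun & neumann B \o (idfun - B) = idfun].
Proof.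
move=> gB; have [bB hB _] := gB; have [N bN NE] := neumann_exists gB.
have bI := @bounded_id R T; have bIB := bounded_sub bI bB.
have Nval (m : int) f u : supp_at m f ->
    N f u = if lev u <= m then iter `|m - lev u|%N B f u else 0.
  move=> fm; pose k := `|m - lev u|%N.
  case: ifPn => mu.
    apply/eqP; rewrite -subr_eq0 -ell2B -opB; apply/eqP.
    have bD := bounded_sub bN (bounded_iter k bB).
    rewrite op_valE//; apply: inner_disjoint => t.
    have [tm|tm] := eqVneq (lev t) m; last by left; exact: fm.
    right; rewrite adjoint_entry// opB ell2B NE /neumann_entry tm mu.
    by rewrite subrr conjC0.
  rewrite op_valE//; apply: inner_disjoint => t.
  have [tm|tm] := eqVneq (lev t) m; last by left; exact: fm.
  by right; rewrite adjoint_entry// NE /neumann_entry tm (negPf mu) conjC0.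
have invr : (idfun - B) \o N = idfun.
  apply: op_entryP => //; first exact: bounded_comp.
  move=> t u /=; rewrite opB ell2B [idfun _]/= NE /neumann_entry.
  have [tu|tu] := boolP (lev u + 1 <= lev t).
    rewrite (_ : lev u <= lev t); last by lia.
    have [k kE] : exists k, `|lev t - lev u|%N = k.+1.
      by exists `|lev t - lev u|%N.-1; lia.
    rewrite kE iterS.
    rewrite (homog_local (g := iter k B (chi t)) bB hB) ?subrr.
      rewrite chiE; case: eqVneq => // uE; move: tu; rewrite uE; lia.
    move=> v vu; rewrite NE /neumann_entry (_ : lev v <= lev t); last by lia.
    by have -> : `|lev t - lev v|%N = k by lia.
  rewrite [B _ _](homog_local (g := 0) bB hB).
    rewrite lin0 ?ell20 ?subr0; last by case: bB.
    case: ifPn => ut.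
      by have -> : `|lev t - lev u|%N = 0%N by lia.
    rewrite chiE; case: eqVneq => // uE; move: ut; rewrite uE; lia.
  move=> v vu; rewrite NE /neumann_entry ell20 ifN//; lia.
have invl : N \o (idfun - B) = idfun.
  apply: op_entryP => //; first exact: bounded_comp.
  move=> t u /=; rewrite opB linB; last by case: bN.
  rewrite ell2B [idfun _]/= NE /neumann_entry.
  have Bs : supp_at (lev t - 1) (B (chi t)) by move=> v; exact: hB.
  rewrite (Nval _ _ _ Bs).
  have [tu|tu] := boolP (lev u + 1 <= lev t).
    rewrite (_ : lev u <= lev t); last by lia.
    rewrite (_ : lev u <= lev t - 1); last by lia.
    have [k kE] : exists k, `|lev t - lev u|%N = k.+1.
      by exists `|lev t - lev u|%N.-1; lia.
    have -> : absz (lev t - 1 - lev u)%R = k by lia.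
    rewrite kE iterSr subrr chiE; case: eqVneq => // uE; move: tu; rewrite uE; lia.
  rewrite (ifN (b := lev u <= lev t - 1)); last by lia.
  rewrite subr0; case: ifPn => ut.
    by have -> : `|lev t - lev u|%N = 0%N by lia.
  rewrite chiE; case: eqVneq => // uE; move: ut; rewrite uE; lia.
by rewrite /neumann (op_invE bIB bN invr invl).
Qed.

Lemma bounded_neumann B : geometric_op B -> bounded_op (neumann B).
Proof. by case/neumann_spec. Qed.

Lemma neumannE B : geometric_op B -> neumann B = idfun + (B \o neumann B).
Proof.
move=> /neumann_spec[_ _ h _]; apply/funext => f.
by apply/eqP; rewrite opD -subr_eq; apply/eqP; exact: (congr1 (@^~ f) h).
Qed.

(** The remainder of the geometric series is [iter n B] times the full sum,
    which gives the rates of convergence of all series built on it. *)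
Lemma neumann_tail B n : geometric_op B ->
  neumann B = \sum_(0 <= k < n) iter k B + (iter n B \o neumann B).
Proof.
move=> gB; elim: n => [|n IHn].
  by rewrite big_geq// add0r; apply/funext.
apply/funext => f; rewrite [in LHS]IHn big_nat_recr// !opD -addrA; congr (_ + _).
rewrite [(iter n B \o neumann B) f]/= [in LHS]neumannE// opD linD; last first.
  by apply: bounded_lin; apply: bounded_iter; case: gB.
by rewrite /= -iterSr iterS.
Qed.

End neumann.
(** * Point evaluation and kernels as diagonals of products *)

Section evaluation.
Variables (R : realType) (T : choiceType) (lev : T -> int).
Local Notation ell2 := (ell2 R T).
Local Notation oper := (oper R T).
Local Notation chi := (chi R).
Local Notation homog := (homog lev).
Local Notation low := (low lev).
Local Notation supp_at := (supp_at lev).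
Local Notation supp_ge := (supp_ge lev).
Local Notation degree_part := (degree_part lev).
Local Notation geometric_op := (geometric_op lev).
Implicit Types (f g h x : ell2) (A B D F G N S : oper).

Lemma adjoint_add A B : bounded_op A -> bounded_op B ->
  adjoint (A + B) = adjoint A + adjoint B.
Proof.
move=> bA bB; have -> : adjoint A = adjoint (A + B - B) by rewrite addrK.
by rewrite adjoint_sub ?subrK//; exact: bounded_add.
Qed.

Lemma adjoint_sum (I : Type) (s : seq I) (F : I -> oper) :
  (forall i, bounded_op (F i)) ->
  adjoint (\sum_(i <- s) F i) = \sum_(i <- s) adjoint (F i).
Proof.
move=> bF; elim: s => [|i s IHs].
  rewrite !big_nil; have b0 := @bounded_0 R T.
  by rewrite -[X in adjoint X](subrr 0) adjoint_sub// subrr.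
by rewrite !big_cons adjoint_add ?IHs//; exact: bounded_sum.
Qed.

Lemma comp_subl A B D : (A - B) \o D = (A \o D) - (B \o D).
Proof. by []. Qed.

Lemma comp_subr A B D : linear D -> D \o (A - B) = (D \o A) - (D \o B).
Proof. by move=> lD; apply/funext => f; rewrite opB /= opB linB. Qed.

Lemma comp_suml (I : Type) (s : seq I) (F : I -> oper) A :
  (\sum_(i <- s) F i) \o A = \sum_(i <- s) (F i \o A).
Proof. by apply/funext => f; rewrite /= !op_sum. Qed.

Lemma comp_sumr (I : Type) (s : seq I) (F : I -> oper) A : linear A ->
  A \o (\sum_(i <- s) F i) = \sum_(i <- s) (A \o F i).
Proof. by move=> lA; apply/funext => f; rewrite /= !op_sum lin_sum. Qed.

Lemma degree_part_neumann B k : geometric_op B -> degree_part (- k%:Z) (neumann B) = iter k B.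
Proof.
move=> gB; have [bN NE _ _] := neumann_spec gB; have [bB _ _] := gB.
apply: op_entryP; [exact: bounded_degree_part|exact: bounded_iter|] => t u.
rewrite degree_partE// NE /neumann_entry; case: eqP => tu.
  by rewrite ifT; [have -> : absz (lev t - lev u)%R = k by lia | lia].
by rewrite (homog_geom gB)//; lia.
Qed.

(** As [iter k B] times the part of degree [k] of [S] is the diagonal of
    [iter k B \o S], the partial sums are diagonals, and so is the error, which
    is then bounded by the tail of the Neumann series. *)
Lemma point_eval_series B S : geometric_op B -> bounded_op S ->
  op_series (fun n => iter n B \o degree_part n%:Z S) = degree_part 0 (neumann B \o S).
Proof.
move=> gB bS; have [bB hB [K [r [K0 r01 Kr]]]] := gB.
have bN := bounded_neumann gB.
have bi n : bounded_op (iter n B) by exact: bounded_iter.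
apply: (op_series_geometric (K := K * opnorm (neumann B) * opnorm S) _ _ r01) => [n||n].
- by apply: bounded_comp => //; exact: bounded_degree_part.
- by apply: bounded_degree_part; exact: bounded_comp.
have -> : \sum_(0 <= k < n) (iter k B \o degree_part k%:Z S) =
    degree_part 0 ((\sum_(0 <= k < n) iter k B) \o S).
  rewrite comp_suml degree_part_sum; last by move=> k; exact: bounded_comp.
  apply: eq_bigr => k _.
  by rewrite (comp_homog_degree_part _ bS (bi k) (homog_geom gB)) subrr.
have bP : bounded_op (\sum_(0 <= k < n) iter k B) by exact: bounded_sum.
have bt : bounded_op (iter n B \o neumann B) by exact: bounded_comp.
rewrite -degree_partB; try exact: bounded_comp.
rewrite -comp_subl [in X in opnorm X](neumann_tail n gB) opprD addNKr.
apply: le_trans (opnorm_degree_part _ _ _) _.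
  by apply: bounded_comp => //; exact: bounded_opp.
apply: le_trans (opnorm_comp (bounded_opp bt) bS) _.
rewrite [leRHS](_ : _ = K * r ^+ n * opnorm (neumann B) * opnorm S); last by ring.
rewrite ler_wpM2r ?opnorm_ge0//.
apply: (@le_trans _ _ (opnorm (iter n B \o neumann B))).
  apply: opnorm_le; first exact: opnorm_ge0.
  by move=> f; rewrite opN l2normN opnorm_ub.
apply: le_trans (opnorm_comp (bi n) bN) _.
by rewrite ler_wpM2r ?opnorm_ge0.
Qed.

(** The factor [iter k B] may be replaced by the whole of [neumann B], of
    which only the part of degree [- k] contributes to the diagonal; the
    remaining sum is a Neumann series in [D]. *)
Lemma kernel_series B D G : geometric_op B -> geometric_op D ->
  bounded_op G -> homog 0 G ->
  op_series (fun n => iter n B \o G \o adjoint (iter n D)) =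
  degree_part 0 (neumann B \o G \o adjoint (neumann D)).
Proof.
move=> gB gD bG hG; have [bB hB _] := gB.
have [bD hD [K [r [K0 r01 Kr]]]] := gD.
have bN := bounded_neumann gB; have bM := bounded_neumann gD.
have bi n : bounded_op (iter n B) by exact: bounded_iter.
have bj n : bounded_op (iter n D) by exact: bounded_iter.
have ba n : bounded_op (adjoint (iter n D)) by exact: bounded_adjoint.
have bNG : bounded_op (neumann B \o G) by exact: bounded_comp.
have bMa := bounded_adjoint bM.
apply: (op_series_geometric
  (K := opnorm (neumann B \o G) * (K * opnorm (neumann D))) _ _ r01) => [n||n].
- exact: bounded_comp (bounded_comp (bi n) bG) (ba n).
- by apply: bounded_degree_part; exact: bounded_comp.
have -> : \sum_(0 <= k < n) (iter k B \o G \o adjoint (iter k D)) =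
    degree_part 0 ((neumann B \o G) \o adjoint (\sum_(0 <= k < n) iter k D)).
  rewrite adjoint_sum// comp_sumr; last by case: bNG.
  rewrite degree_part_sum; last by move=> k; exact: bounded_comp bNG (ba k).
  apply: eq_bigr => k _.
  have bGD : bounded_op (G \o adjoint (iter k D)).
    exact: bounded_comp bG (ba k).
  have hGD : homog k%:Z (G \o adjoint (iter k D)).
    rewrite -[k%:Z]addr0; apply: (homog_comp bG (ba k) hG).
    by rewrite -[k%:Z]opprK; exact: homog_adjoint (bj k) (homog_geom gD).
  have := comp_degree_part_homog (- k%:Z) bN bGD hGD.
  by rewrite subrr degree_part_neumann.
have bP : bounded_op (\sum_(0 <= k < n) iter k D) by exact: bounded_sum.
have bt : bounded_op (iter n D \o neumann D) by exact: bounded_comp.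
have bPa := bounded_adjoint bP; have bta := bounded_adjoint bt.
rewrite -degree_partB; try exact: bounded_comp.
rewrite -comp_subr; last by case: bNG.
rewrite [in X in opnorm X](neumann_tail n gD) adjoint_add// opprD addNKr.
apply: le_trans (opnorm_degree_part _ _ _) _.
  by apply: bounded_comp => //; exact: bounded_opp.
apply: le_trans (opnorm_comp bNG (bounded_opp bta)) _.
rewrite -mulrA ler_wpM2l ?opnorm_ge0//.
apply: (@le_trans _ _ (opnorm (adjoint (iter n D \o neumann D)))).
  apply: opnorm_le; first exact: opnorm_ge0.
  by move=> f; rewrite opN l2normN opnorm_ub.
apply: le_trans (opnorm_adjoint bt) _.
apply: le_trans (opnorm_comp (bj n) bM) _.
by rewrite mulrAC ler_wpM2r ?opnorm_ge0.
Qed.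

Lemma op_inv_adjoint B : geometric_op B ->
  op_inv (idfun - adjoint B) = adjoint (neumann B).
Proof.
move=> gB; have [bB _ _] := gB; have [bN _ e1 e2] := neumann_spec gB.
have bI := @bounded_id R T; have bIB := bounded_sub bI bB.
have adj : idfun - adjoint B = adjoint (idfun - B) by rewrite adjoint_sub// adjoint_id.
rewrite adj; apply: op_invE; try exact: bounded_adjoint.
  by rewrite -adjoint_comp// e2 adjoint_id.
by rewrite -adjoint_comp// e1 adjoint_id.
Qed.

Lemma low_adjoint_neumann B : geometric_op B -> low 0 (adjoint (neumann B)).
Proof.
move=> gB t u; rewrite addr0 => ut; have [bN NE _ _] := neumann_spec gB.
by rewrite adjoint_entry// NE /neumann_entry leNgt ut conjC0.
Qed.

(** If the evaluation of a causal [F] at [B] vanishes, then [F] is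
    [idfun - B] times a strictly causal operator: the entry of
    [neumann B \o F] of degree [- m] is [iter m B] applied to the diagonal,
    because the first [m] terms of the series do not reach that far. *)
Lemma strictly_causal_of_eval0 B F : geometric_op B -> bounded_op F -> low 0 F ->
  degree_part 0 (neumann B \o F) = 0 -> low 1 (neumann B \o F).
Proof.
move=> gB bF lF F0 t u tu; have [bB hB _] := gB.
have bN := bounded_neumann gB; have bNF := bounded_comp bN bF.
have [m mE] : exists m : nat, lev u + m%:Z = lev t by exists `|lev t - lev u|%N; lia.
rewrite /= (neumann_tail m gB) opD ell2D op_sum ell2_sum big_nat big1 ?add0r; last first.
  move=> k /andP[_ km].
  have bi : bounded_op (iter k B) by exact: bounded_iter.
  have lk := homog_low (homog_geom (k := k) gB).
  by apply: (low_comp bi bF lk lF); lia.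
have bi : bounded_op (iter m B) by exact: bounded_iter.
rewrite (homog_local (g := 0) bi (homog_geom gB)) ?lin0 ?ell20//.
  by case: bi.
move=> v vu; rewrite ell20.
have := congr1 (fun X : oper => X (chi t) v) F0.
by rewrite degree_partE// op0 ell20 ifT//; apply/eqP; lia.
Qed.

Section with_evaluation.
Variables (B S : oper).
Hypotheses (gB : geometric_op B) (bS : bounded_op S) (lS : low 0 S).
Let s := degree_part 0 (neumann B \o S).

Let bN : bounded_op (neumann B). Proof. exact: bounded_neumann gB. Qed.
Let bNS : bounded_op (neumann B \o S). Proof. exact: bounded_comp. Qed.
Let bs : bounded_op s. Proof. exact: bounded_degree_part. Qed.

Lemma residual_strictly_causal : low 1 (neumann B \o (S - s)).
Proof.
have hs : homog 0 s by exact: homog_degree_part.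
apply: strictly_causal_of_eval0 => //; first exact: bounded_sub.
  by apply: low_sub => //; exact: homog_low.
rewrite comp_subr; last exact: bounded_lin.
rewrite degree_partB//; last exact: bounded_comp.
have := comp_degree_part_homog 0 bN bs hs; rewrite addr0 => <-.
have := degree_part_neumann 0 gB; rewrite oppr0 => ->.
by apply/funext => f; rewrite opB /= subrr.
Qed.

Lemma adjoint_eval_supp n x : supp_at n x ->
  supp_ge n (adjoint s (adjoint (neumann B) x)).
Proof.
move=> xn; have xg := supp_at_ge xn; have bsa := bounded_adjoint bs.
have hs : homog 0 s by exact: homog_degree_part.
have ls : low 0 (adjoint s) by rewrite -oppr0; apply/homog_low/homog_adjoint.
have := low_supp (bounded_adjoint bN) (low_adjoint_neumann gB) xg.
by rewrite addr0 => /(low_supp bsa ls); rewrite addr0.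
Qed.

(** Tested against [chi u], the difference is the entry of the strictly causal
    [neumann B \o (S - s)] between the level of [u] and a level not below it. *)
Lemma adjoint_eval_agree n x u : supp_at n x -> n <= lev u ->
  adjoint s (adjoint (neumann B) x) u = adjoint S (adjoint (neumann B) x) u.
Proof.
move=> xn nu; rewrite -!inner_chir !inner_adjl// ; apply/eqP.
rewrite eq_sym -subr_eq0 -innerBr -linB; last exact: bounded_lin.
apply/eqP.
apply: inner_disjoint => t; have [tn|tn] := eqVneq (lev t) n; last by left; exact: xn.
by right; apply: residual_strictly_causal; lia.
Qed.

(** The difference of the two products is a strictly causal operator times
    causal ones, so it has no diagonal. *)
Lemma kernel_identity D s' : geometric_op D -> bounded_op s' -> homog 0 s' ->
  degree_part 0 (neumann B \o (idfun - (s \o adjoint s')) \o adjoint (neumann D)) =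
  degree_part 0 (neumann B \o ((idfun - (S \o adjoint s')) \o adjoint (neumann D))).
Proof.
move=> gD bs' hs'; have bM := bounded_adjoint (bounded_neumann gD).
have ba := bounded_adjoint bs'; have bI := @bounded_id R T.
have b1 := bounded_comp bs ba; have b2 := bounded_comp bS ba.
apply/eqP; rewrite -subr_eq0 -degree_partB; last 2 first.
- by do 2!apply: bounded_comp => //; exact: bounded_sub.
- by do 2!apply: bounded_comp => //; exact: bounded_sub.
rewrite (_ : _ - _ = (neumann B \o (S - s)) \o (adjoint s' \o adjoint (neumann D))).
  have bNr : bounded_op (neumann B \o (S - s)).
    by apply: bounded_comp => //; exact: bounded_sub.
  have bad := bounded_comp ba bM.
  apply/eqP; apply: (@degree_part_low _ _ _ _ 1) => //; first exact: bounded_comp.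
  rewrite -[X in low X](add0r 1); apply: low_comp => //.
    exact: residual_strictly_causal.
  rewrite -[X in low X](add0r 0); apply: low_comp => //.
    by rewrite -oppr0; apply/homog_low/homog_adjoint.
  exact: low_adjoint_neumann.
apply/funext => f; rewrite opB /= -linB; last exact: bounded_lin.
rewrite !opB; congr (neumann B _).
by rewrite /= opprB addrC addrA subrK.
Qed.

End with_evaluation.

(** Any ratio strictly between the limit and 1 bounds all large powers; the
    finitely many others are absorbed in the constant. *)
Lemma geometric_of_limit B (l : R) : bounded_op B -> homog (-1) B -> l < 1 ->
  (fun n => opnorm (iter n B) `^ (n%:R^-1)) @ \oo --> l -> geometric_op B.
Proof.
move=> bB hB l1 lim; split => //.
(* The maximum keeps the ratio positive whatever the sign of [l]. *)
pose r : R := Num.max ((l + 1) / 2) 2^-1.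
have r01 : 0 < r < 1.
  by rewrite /r lt_max gt_max invr_gt0 ltr0n orbT /=; apply/andP; split; lra.
have lr : l < r by rewrite lt_max; apply/orP; left; lra.
have [r0 r1] := andP r01.
have [N _ hN] := cvgr_lt l lim _ lr.
have bi n : bounded_op (iter n B) by exact: bounded_iter.
have t0 n : 0 <= opnorm (iter n B) / r ^+ n.
  by rewrite divr_ge0 ?opnorm_ge0// exprn_ge0// ltW.
pose K := \sum_(0 <= k < N.+1) opnorm (iter k B) / r ^+ k + 1.
have K1 : 1 <= K by rewrite lerDr sumr_ge0.
exists K, r; split; [exact: le_trans K1|by rewrite ltW|] => n.
have rn0 : 0 < r ^+ n by exact: exprn_gt0.
have [nN|Nn] := ltnP n N.+1.
  rewrite -ler_pdivrMr// /K big_mkord (bigD1 (Ordinal nN))//= -addrA lerDl.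
  by rewrite addr_ge0// sumr_ge0.
have n0 : (n%:R : R) != 0 by rewrite pnatr_eq0; lia.
have := hN n (ltnW Nn); rewrite /= => h.
apply: (@le_trans _ _ (r ^+ n)); last by rewrite ler_peMl// ltW.
have -> : opnorm (iter n B) = (opnorm (iter n B) `^ n%:R^-1) ^+ n.
  by rewrite -powR_mulrn ?powR_ge0// -powRrM mulVf// powRr1// opnorm_ge0.
by rewrite lerXn2r ?nnegrE ?powR_ge0 ?ltW.
Qed.

End evaluation.
(** * The level function of a homogeneous tree *)

Section tree_levels.
Variables (q : nat) (T : choiceType) (e : rel T).
Hypothesis tree : homogeneous_tree q e.
Variable oo : set (nat -> T).
Hypothesis bd : boundary_point e oo.

Let e_sym : symmetric e. Proof. by case: tree. Qed.
Let e_irr : irreflexive e. Proof. by case: tree. Qed.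

Definition reduced_walk (L : nat) (w : nat -> T) :=
  (forall k, (k < L)%N -> e (w k) (w k.+1)) /\
  (forall k, (k.+1 < L)%N -> w k != w k.+2).

(** A closed walk without backtracking contains a cycle: take a repetition
    at minimal distance; the nodes in between are distinct, and there are at
    least three of them. *)
Lemma reduced_walk_inj L w i j : reduced_walk L w -> (i < j <= L)%N ->
  w i != w j.
Proof.
move=> [we wb] /andP[ij jL].
have [d dE] : exists d, (j = i + d.+1)%N by exists (j - i).-1; lia.
elim/ltn_ind: d i j ij jL dE => d IHd i j ij jL dE.
apply/eqP => wij.
(* A repetition at distance 1 is a loop, one at distance 2 a backtracking. *)
have d2 : (2 <= d)%N.
  case: d dE {IHd} => [|[|d]] //= dE.
    by have := we i; rewrite -[i.+1]addn1 -dE wij e_irr; move=> /(_ ltac:(lia)).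
  by have := wb i; rewrite -[i.+2]addn2 -dE wij eqxx; move=> /(_ ltac:(lia)).
case: tree => _ _ _ acyc _.
pose p := [seq w k | k <- iota i d.+1].
have pu : uniq p.
  rewrite map_inj_in_uniq ?iota_uniq// => a b; rewrite !mem_iota => ha hb wab.
  apply/eqP; move: wab; apply: contraPeq => ab.
  wlog lab : a b ha hb ab / (a < b)%N.
    move=> H; case: (ltngtP a b) ab => // h _; first by apply: H => //; rewrite ltn_eqF.
    by move=> /esym; apply: H => //; rewrite ltn_eqF.
  by apply/eqP; apply: (IHd (b - a).-1); lia.
have := acyc p; rewrite /p size_map size_iota ltnS => /(_ d2 pu) /negP; apply.
rewrite /= rcons_path; apply/andP; split.
  have pathw : forall n a, (a + n <= L)%N -> path e (w a) [seq w k | k <- iota a.+1 n].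
    elim=> [//|n IHn] a ha /=; rewrite we; last by lia.
    by apply: IHn; lia.
  by apply: pathw; lia.
have -> : last (w i) [seq w k | k <- iota i.+1 d] = w (i + d)%N.
  by rewrite last_map -nth_last; case: d d2 {IHd dE pu p} => // d _;
     rewrite size_iota nth_iota//=; congr w; lia.
by rewrite wij dE addnS we//; lia.
Qed.

Lemma infinite_path_reduced p L : infinite_path e p -> reduced_walk L p.
Proof. by move=> ip; split => k _; case: (ip k). Qed.

Lemma infinite_path_inj p i j : infinite_path e p -> p i = p j -> i = j.
Proof.
move=> ip pij; case: (ltngtP i j) => // ij.
  by have := @reduced_walk_inj j p i j (infinite_path_reduced _ ip); rewrite ij leqnn pij eqxx => /(_ isT).
by have := @reduced_walk_inj i p j i (infinite_path_reduced _ ip); rewrite ij leqnn pij eqxx => /(_ isT).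
Qed.

(** Two paths to the same end from the same node agree: after the first
    disagreement, running back along one and out along the other is a walk
    without backtracking, which cannot return to the common tail. *)
Lemma infinite_path_unique p r : infinite_path e p -> infinite_path e r ->
  equivalent_paths p r -> p 0%N = r 0%N -> p = r.
Proof.
move=> ip ir [m [n ptail]] pr0; apply/funext => k.
elim/ltn_ind: k => k IHk; apply/eqP/negPn/negP => /eqP pk.
case: k pk IHk => [|i] pk IHk; first by rewrite pr0 in pk.
have pri : p i = r i by apply: IHk.
pose N := (n + i.+1 - i)%N.
(* Back along [r] from the common tail to the branching node, then out along
   [p]. *)
pose w j := if (j <= N)%N then r (i + N - j)%N else p (i + j - N)%N.
pose L := (N + (m + i.+1 - i))%N.
have rw : reduced_walk L w.
  split=> j jL; rewrite /w.
    case: (ltnP j N) => jN.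
      rewrite (ltnW jN) e_sym.
      have -> : (i + N - j = (i + N - j.+1).+1)%N by lia.
      by case: (ir (i + N - j.+1)%N).
    have -> : (i + j.+1 - N = (i + j - N).+1)%N by lia.
    case: ifP => jN'; last by case: (ip (i + j - N)%N).
    have -> : (i + N - j = i)%N by lia.
    have -> : (i + j - N = i)%N by lia.
    by rewrite -pri; case: (ip i).
  case: (ltnP j.+1 N) => jN.
    rewrite ifT; last by lia.
    have -> : (i + N - j = (i + N - j.+2).+2)%N by lia.
    by rewrite eq_sym; case: (ir (i + N - j.+2)%N).
  have [jE|jN'] := eqVneq j.+1 N.
    rewrite ifT; last by lia.
    have -> : (i + N - j = i.+1)%N by lia.
    have -> : (i + j.+2 - N = i.+1)%N by lia.
    by rewrite eq_sym; apply/eqP.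
  have -> : (i + j.+2 - N = (i + j - N).+2)%N by lia.
  case: ifP => jN''; last by case: (ip (i + j - N)%N).
  have -> : (i + N - j = i)%N by lia.
  have -> : (i + j - N = i)%N by lia.
  by rewrite -pri; case: (ip i).
have := @reduced_walk_inj L w 0 L rw.
rewrite leqnn andbT => /(_ ltac:(lia)); rewrite /w leq0n subn0.
rewrite ifF; last by lia.
have -> : (i + N = n + i.+1)%N by lia.
have -> : (i + L - N = m + i.+1)%N by lia.
by rewrite ptail eqxx.
Qed.

Lemma equivalent_sym (p r : nat -> T) : equivalent_paths p r -> equivalent_paths r p.
Proof. by move=> [m [n h]]; exists n, m. Qed.

Lemma equivalent_trans (p r s : nat -> T) : equivalent_paths p r -> equivalent_paths r s ->
  equivalent_paths p s.
Proof.
move=> [m [n h]] [m' [n' h']]; exists (m + m')%N, (n' + n)%N => k.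
by rewrite -addnA h addnCA h' addnA.
Qed.

Lemma oo_infinite p : oo p -> infinite_path e p.
Proof. by case: bd => p0 _ -> [? _]. Qed.

Lemma oo_equivalent p r : oo p -> oo r -> equivalent_paths p r.
Proof.
case: bd => p0 _ -> [_ h] [_ h'].
exact: equivalent_trans (equivalent_sym h) h'.
Qed.

Lemma oo_closed p r : oo p -> infinite_path e r -> equivalent_paths p r -> oo r.
Proof.
case: bd => p0 _ -> [_ h] ir h'; split => //; exact: equivalent_trans h h'.
Qed.

Definition path_tail (p : nat -> T) k := p k.+1.

Lemma oo_tail p : oo p -> oo (path_tail p).
Proof.
move=> op; apply: (oo_closed op); first by move=> k; exact: (oo_infinite op k.+1).
by exists 1%N, 0%N => k; rewrite /path_tail add0n add1n.
Qed.

Definition prepend (t : T) (p : nat -> T) k := if k is k'.+1 then p k' else t.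

Lemma oo_prepend p t : oo p -> e t (p 0%N) -> p 1%N != t -> oo (prepend t p).
Proof.
move=> op et pt; apply: (oo_closed op).
  case=> [|k] /=; last exact: (oo_infinite op k).
  split => //; last by rewrite eq_sym.
  by apply: contraTneq et => ->; rewrite e_irr.
by exists 0%N, 1%N => k; rewrite add0n add1n.
Qed.

(** Every node starts a path to the boundary point: follow an edge path from
    a node that does, either dropping or prepending a node at each step. *)
Lemma oo_from t : exists p, oo p /\ p 0%N = t.
Proof.
have [p0 op0] : exists p, oo p.
  by case: bd => p ip ->; exists p; split => //; exists 0%N, 0%N.
have [_ _ conn _ _] := tree; have [s [es <-]] := conn (p0 0%N) t.
elim: s p0 op0 es => [|u s IHs] p op /=; first by exists p.
move=> /andP[pu es]; have [E|ne] := eqVneq (p 1%N) u.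
  by rewrite -E in es *; exact: (IHs (path_tail p) (oo_tail op) es).
by apply: (IHs (prepend u p) _ es); apply: oo_prepend => //; rewrite e_sym.
Qed.

Lemma repP t : oo (rep oo t) /\ rep oo t 0%N = t.
Proof.
rewrite /rep; have [p hp] := oo_from t.
exact: (@xgetI _ (fun=> t) [set p | oo p /\ p 0%N = t] p hp).
Qed.

Lemma rep_eq p t : oo p -> p 0%N = t -> rep oo t = p.
Proof.
move=> op pt; have [op' r0] := repP t.
apply: infinite_path_unique; [exact: oo_infinite|exact: oo_infinite| |].
  exact: oo_equivalent.
by rewrite r0.
Qed.

Definition parent t := rep oo t 1%N.

Lemma rep_iter t k : rep oo t k = iter k parent t.
Proof.
elim: k t => [|k IHk] t; first by case: (repP t).
rewrite iterSr -IHk (@rep_eq (path_tail (rep oo t)) (parent t))//.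
by apply: oo_tail; case: (repP t).
Qed.

Lemma parent_iter_inj t i j : iter i parent t = iter j parent t -> i = j.
Proof.
by rewrite -!rep_iter; apply: infinite_path_inj; apply: oo_infinite; case: (repP t).
Qed.

Lemma parents_meet s t : exists m n, iter m parent s = iter n parent t.
Proof.
have [m [n h]] : equivalent_paths (rep oo s) (rep oo t).
  by apply: oo_equivalent; [case: (repP s)|case: (repP t)].
by exists m, n; have := h 0%N; rewrite !addn0 !rep_iter.
Qed.

Lemma edge_parent t : e t (parent t).
Proof.
have [op r0] := repP t; have := oo_infinite op 0%N.
by rewrite r0 => -[].
Qed.

Lemma edge_cases s t : e s t -> parent s = t \/ parent t = s.
Proof.
move=> st; have [->|ne] := eqVneq (parent s) t; [by left|right].
have [op r0] := repP s.
rewrite /parent (@rep_eq (prepend t (rep oo s)) t)//.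
by apply: oo_prepend; rewrite // r0 e_sym.
Qed.

Definition level_spec (b t : T) (z : int) :=
  exists m n, iter m parent t = iter n parent b /\ z = m%:Z - n%:Z.

(** Ancestors of the base node at different heights are distinct. *)
Lemma level_unique b t y z : level_spec b t y -> level_spec b t z -> y = z.
Proof.
move=> [m [n [h ->]]] [m' [n' [h' ->]]].
have : (n + m' = n' + m)%N.
  apply: (@parent_iter_inj b); rewrite (addnC n) iterD -h -iterD.
  by rewrite (addnC n') [RHS]iterD -h' -iterD addnC.
by lia.
Qed.

Variable b : T.

Definition level (t : T) : int := xget 0 [set z | level_spec b t z].

Lemma levelP t : level_spec b t (level t).
Proof.
have [m [n h]] := parents_meet t b.
apply: (@xgetI _ (0 : int) [set z | level_spec b t z] (m%:Z - n%:Z)).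
by exists m, n.
Qed.

Lemma level_parent t : level (parent t) = level t - 1.
Proof.
have [m [n [h E]]] := levelP (parent t).
rewrite -iterSr in h; have hs : level_spec b t (m.+1%:Z - n%:Z) by exists m.+1, n.
by rewrite (level_unique (levelP t) hs) E; lia.
Qed.

Lemma level_iter k t : level (iter k parent t) = level t - k%:Z.
Proof.
elim: k => [|k IHk]; first by rewrite subr0.
by rewrite iterS level_parent IHk; lia.
Qed.

Lemma meet_level m n s t : iter m parent s = iter n parent t ->
  m%:Z - n%:Z = level s - level t.
Proof. by move=> h; have := level_iter m s; rewrite h level_iter; lia. Qed.

Lemma hopsP s t : (exists n, iter (hops oo s t) parent s = iter n parent t) /\
  forall m n, iter m parent s = iter n parent t -> (hops oo s t <= m)%N.
Proof.
pose P := [set m | exists n, forall k, rep oo s (m + k)%N = rep oo t (n + k)%N].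
have PE m n : iter m parent s = iter n parent t -> P m.
  by move=> h; exists n => k; rewrite !rep_iter addnC iterD h -iterD addnC.
have Pex : exists m, `[< P m >].
  by have [m [n h]] := parents_meet s t; exists m; apply/asboolP; exact: PE h.
have hx : [set m | P m /\ forall m', P m' -> (m <= m')%N] (ex_minn Pex).
  case: ex_minnP => m /asboolP Pm hm; split => // m' Pm'.
  by apply: hm; apply/asboolP.
have := @xgetI _ 0%N _ _ hx; rewrite -/(hops oo s t) => -[[n hn] hmin]; split.
  by exists n; have := hn 0%N; rewrite !addn0 !rep_iter.
by move=> m n' h; apply: hmin; exact: PE h.
Qed.

(** The least [m] and the least [n] are attained together, since [m - n] is
    the same for all pairs of meeting ancestors. *)
Lemma hops_meet s t : iter (hops oo s t) parent s = iter (hops oo t s) parent t.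
Proof.
have [[n h] hmin] := hopsP s t; have [[m h'] hmin'] := hopsP t s.
have nE : hops oo t s = n.
  have := hmin _ _ (esym h'); have := hmin' _ _ (esym h).
  by have := meet_level h; have := meet_level h'; lia.
by rewrite nE.
Qed.

Lemma hops_level s t : (hops oo s t)%:Z - (hops oo t s)%:Z = level s - level t.
Proof. exact/meet_level/hops_meet. Qed.

Lemma hops_ancestor k t : hops oo t (iter k parent t) = k /\
  hops oo (iter k parent t) t = 0%N.
Proof.
have h0 : hops oo (iter k parent t) t = 0%N.
  have [_ hmin] := hopsP (iter k parent t) t.
  by apply/eqP; rewrite -leqn0; apply: (hmin 0%N k).
by split => //; have := hops_level t (iter k parent t); rewrite h0 level_iter; lia.
Qed.

Lemma dist_meet s t : dist oo s (meet oo s t) = hops oo s t.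
Proof.
rewrite /dist /meet rep_iter; have [-> ->] := hops_ancestor (hops oo s t) s.
by rewrite addn0.
Qed.

Lemma dist_meetr s t : dist oo t (meet oo s t) = hops oo t s.
Proof.
rewrite /dist /meet rep_iter hops_meet.
by have [-> ->] := hops_ancestor (hops oo t s) t; rewrite addn0.
Qed.

Lemma preceqE s t : preceq oo s t <-> level s <= level t.
Proof.
by rewrite /preceq dist_meet dist_meetr; have := hops_level s t; lia.
Qed.

Lemma asympE s t : asymp oo s t <-> level s = level t.
Proof.
by rewrite /asymp dist_meet dist_meetr; have := hops_level s t; lia.
Qed.

Lemma childE t s : (preceq oo t s /\ dist oo t s = 1%N) <-> parent s = t.
Proof.
split=> [[/preceqE ts d1]|<-].
  have h := hops_level t s; have := hops_meet t s.
  rewrite /dist in d1.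
  have -> : hops oo t s = 0%N by lia.
  by have -> : hops oo s t = 1%N by lia.
split; first by apply/preceqE; rewrite level_parent; lia.
by have [h1 h2] := hops_ancestor 1 s; rewrite /dist h1 h2.
Qed.

Variable alpha : 'I_q -> T -> T.
Hypothesis shifts : primitive_shifts oo alpha.

Lemma parent_alpha j t : parent (alpha j t) = t.
Proof.
apply/childE; have : range (alpha ^~ t) (alpha j t) by exists j.
by rewrite shifts.
Qed.

Lemma alpha_onto s : exists j, alpha j (parent s) = s.
Proof.
have : range (alpha ^~ (parent s)) s by rewrite shifts; apply/childE.
by move=> [j _ h]; exists j.
Qed.

(** The neighbours of [t] are its parent and its children; there are [q.+1]
    of them, so the [q] maps reach distinct children. *)
Lemma alpha_inj t : injective (alpha ^~ t).
Proof.
have [_ _ _ _ deg] := tree.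
have dE : [set s | e t s] = [set` parent t :: [seq alpha j t | j <- enum 'I_q]].
  apply/seteqP; split => s /=.
    move=> /edge_cases[<-|ts]; rewrite inE ?eqxx//; apply/orP; right.
    by have [j <-] := alpha_onto s; rewrite ts map_f// mem_enum.
  rewrite inE => /orP[/eqP ->|/mapP[j _ ->]]; first exact: edge_parent.
  by rewrite e_sym -{2}(parent_alpha j t) edge_parent.
set s := _ :: _ in dE.
have us : uniq s.
  have szs : size s = q.+1 by rewrite /s /= size_map size_enum_ord.
  have card := card_fset_set (deg t); rewrite dE in card.
  have szu : size (undup s) = q.+1.
    rewrite -card; apply/perm_size/uniq_perm; rewrite ?undup_uniq ?finmap.fset_uniq//.
    move=> x; rewrite mem_undup; apply/idP/idP.
      by move=> xs; rewrite in_fset_set ?inE//; exact: finite_seq.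
    by rewrite in_fset_set ?inE//; exact: finite_seq.
  have := ltn_size_undup s; rewrite szu szs ltnn.
  by move=> /esym/negbFE.
by move: us; rewrite /s /= => /andP[_]; move/(@injectiveP _ _ (alpha ^~ t)).
Qed.

End tree_levels.
(** * Words, coefficients and evaluations in terms of degrees *)

Arguments row_alpha : simpl never.
Arguments word_op : simpl never.

Section leveled.
Variables (R : realType) (T : choiceType) (oo : set (nat -> T)).
Variables (lev : T -> int) (par : T -> T).
Variables (q : nat) (alpha : 'I_q -> T -> T).
Hypothesis lev_preceq : forall s t, preceq oo s t <-> lev s <= lev t.
Hypothesis lev_asymp : forall s t, asymp oo s t <-> lev s = lev t.
Hypothesis lev_par : forall t, lev (par t) = lev t - 1.
Hypothesis par_alpha : forall j t, par (alpha j t) = t.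
Hypothesis alpha_par : forall t, exists j, alpha j (par t) = t.
Hypothesis alpha_injective : forall t, injective (alpha ^~ t).

Local Notation C := (complex R).
Local Notation normc := (@ComplexField.Normc.normc R).
Local Notation ell2 := (ell2 R T).
Local Notation oper := (oper R T).
Local Notation chi := (chi R).
Local Notation homog := (homog lev).
Local Notation low := (low lev).
Local Notation supp_at := (supp_at lev).
Local Notation supp_ge := (supp_ge lev).
Local Notation degree_part := (degree_part lev).
Local Notation geometric_op := (geometric_op lev).
Local Notation word_op := (@word_op R T q alpha).
Implicit Types (f g h x : ell2) (A B D F G N S : oper) (c d : 'I_q -> oper).

Lemma lev_iter_par k t : lev (iter k par t) = lev t - k%:Z.
Proof.
elim: k => [|k IHk]; first by rewrite subr0.
by rewrite iterS lev_par IHk; lia.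
Qed.

Lemma iter_par_act t w : iter (size w) par (act alpha t w) = t.
Proof.
elim/last_ind: w t => [//|w j IHw] t.
by rewrite size_rcons /act foldl_rcons iterSr par_alpha; exact: IHw.
Qed.

Lemma lev_act t w : lev (act alpha t w) = lev t + (size w)%:Z.
Proof. by have := lev_iter_par (size w) (act alpha t w); rewrite iter_par_act; lia. Qed.

Lemma act_word_exists k t : exists w : k.-tuple 'I_q, act alpha (iter k par t) w = t.
Proof.
elim: k t => [|k IHk] t; first by exists [tuple].
have [j jt] := alpha_par t; have [w wt] := IHk (par t).
by exists [tuple of rcons w j]; rewrite iterSr /act foldl_rcons -/(act _ _ _) wt.
Qed.

Lemma act_word_inj t (w w' : seq 'I_q) : size w = size w' ->
  act alpha t w = act alpha t w' -> w = w'.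
Proof.
elim/last_ind: w w' => [|w j IHw] w'; first by move=> /esym/size0nil.
case/lastP: w' => [|w' j']; first by rewrite size_rcons.
rewrite !size_rcons => -[sw]; rewrite /act !foldl_rcons -!/(act _ _ _) => E.
have E' : act alpha t w = act alpha t w'.
  by have := congr1 par E; rewrite !par_alpha.
by rewrite (IHw _ sw E'); move: E; rewrite E' => /alpha_injective ->.
Qed.

Lemma word_opE w f t : word_op w f t = f (act alpha t w).
Proof.
rewrite /word_op insubdK//; apply: (@in_l2 _ _ _ (l2norm f ^+ 2)) => s us.
rewrite -(big_map (fun t => act alpha t w) xpredT (fun t => normc (f t) ^+ 2)).
apply: l2norm_bound; rewrite map_inj_in_uniq// => a b _ _ ab.
by rewrite -(iter_par_act a w) ab iter_par_act.
Qed.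

Lemma bounded_word w : bounded_op (word_op w).
Proof.
apply: (@bounded_opI _ _ _ 1) => [a f g|f].
  by apply: ell2P => t; rewrite ell2D ell2Z !word_opE.
rewrite mul1r; apply: l2norm_le; first exact: l2norm_ge0.
move=> s us; under eq_bigr do rewrite word_opE.
rewrite -(big_map (fun t => act alpha t w) xpredT (fun t => normc (f t) ^+ 2)).
apply: l2norm_bound; rewrite map_inj_in_uniq// => a b _ _ ab.
by rewrite -(iter_par_act a w) ab iter_par_act.
Qed.

Lemma word_op_chi w t : word_op w (chi t) =
  (act alpha (iter (size w) par t) w == t)%:R *: chi (iter (size w) par t).
Proof.
apply: ell2P => s; rewrite word_opE ell2Z !chiE.
have [<-|ne] := eqVneq (act alpha s w) t; first by rewrite iter_par_act !eqxx mulr1.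
have [sE|_] := eqVneq s (iter (size w) par t); last by rewrite mulr0.
by rewrite -sE (negPf ne) mul0r.
Qed.

Lemma homog_word w : homog (- (size w)%:Z) (word_op w).
Proof.
move=> t u tu; rewrite word_opE chiE; case: eqVneq => // E; move: tu.
by rewrite -E lev_act; lia.
Qed.

(** The words of a fixed length address each node below a given one exactly
    once. *)
Lemma sum_words_id k : \sum_(w : k.-tuple 'I_q) (adjoint (word_op w) \o word_op w) = idfun.
Proof.
have bw w := bounded_word w.
apply: op_entryP; [|exact: bounded_id|].
  by apply: bounded_sum => w; apply: bounded_comp => //; exact: bounded_adjoint.
move=> t u; rewrite op_sum ell2_sum.
rewrite (eq_bigr (fun w : k.-tuple 'I_q => (u == t)%:R *
    (act alpha (iter k par t) w == t)%:R)); last first.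
  move=> w _; rewrite -inner_chir /= inner_adjl// !word_op_chi size_tuple.
  rewrite innerZl innerZr inner_chir chiE conjC_nat.
  have [->|tu] := eqVneq u t; first by rewrite eqxx mul1r mulr1 -natrM mulnb andbb.
  rewrite mul0r; case: eqVneq => [E|_]; last by rewrite mul0r.
  case: eqVneq => [E'|_]; last by rewrite mul0r mulr0.
  have [EE|_] := eqVneq (iter k par u) (iter k par t).
    by case/eqP: tu; rewrite -E -E' EE.
  by rewrite !mulr0.
have [w0 w0t] := act_word_exists k t.
rewrite (bigD1 w0) // [X in _ + X = _]big1; last first.
  move=> w /negP ww0; case: (eqVneq (act alpha (iter k par t) w) t) => [wt|_]; last by rewrite mulr0.
  case: ww0; apply/eqP/val_inj.
  by apply: (@act_word_inj (iter k par t)); rewrite ?size_tuple// wt.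
by rewrite w0t eqxx mulr1 addr0.
Qed.

(** Cutting [S] down to degree [size w] and reading it along [w] keeps exactly
    the entries that define the coefficient. *)
Lemma coefE S w : bounded_op S -> coef oo alpha S w = word_op w \o degree_part (size w)%:Z S.
Proof.
move=> bS; have bp := bounded_degree_part lev (size w)%:Z bS.
have bX := bounded_comp (bounded_word w) bp.
have : [set A | bounded_op A /\ forall t s : T,
    A (chi t) s = if `[< asymp oo t s >] then S (chi t) (act alpha s w)
                    else 0] (word_op w \o degree_part (size w)%:Z S).
  split=> // t s /=; rewrite word_opE degree_partE// lev_act.
  have -> : `[< asymp oo t s >] = (lev t == lev s).
    by apply/idP/eqP => [/asboolP/lev_asymp//|?]; apply/asboolP/lev_asymp.
  by rewrite (inj_eq (addIr _)).
move=> h; have [bA AE] := xgetI (0 : oper) h.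
rewrite -/(coef oo alpha S w) in bA AE; apply: op_entryP => // t s.
by rewrite AE; case: h => _ ->.
Qed.

Lemma sum_coefE S k : bounded_op S ->
  \sum_(w : k.-tuple 'I_q) (adjoint (word_op w) \o coef oo alpha S w) =
  degree_part k%:Z S.
Proof.
move=> bS; rewrite (eq_bigr (fun w : k.-tuple 'I_q =>
  (adjoint (word_op w) \o word_op w) \o degree_part k%:Z S)); last first.
  by move=> w _; rewrite coefE// size_tuple.
by rewrite -comp_suml sum_words_id.
Qed.

Lemma causalE A : causal oo A <-> bounded_op A /\ low 0 A.
Proof.
split=> [[bA cA]|[bA lA]]; split => //.
  move=> t u; rewrite addr0 => ut; apply: (cA u) => [v /lev_preceq vu|]; last exact/lev_preceq.
  by apply: (@supp_ge_chi _ _ lev t); lia.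
move=> s f f0 t /lev_preceq ts; have fs : supp_ge (lev s + 1) f.
  by move=> v vs; apply/f0/lev_preceq; lia.
by apply: (low_supp bA lA fs); lia.
Qed.

(** Causality of the adjoint says that levels are not raised. *)
Lemma constant_opE A : constant_op oo A <-> bounded_op A /\ homog 0 A.
Proof.
split=> [[/causalE[bA lA] /causalE[bB lB]]|[bA hA]].
  split=> // t u; rewrite addr0 neq_lt => /orP[ut|tu].
    by apply: lA; rewrite addr0.
  rewrite -[LHS]conjCK -adjoint_entry// lB ?conjC0//; lia.
split; apply/causalE; first by split=> //; exact: homog_low.
split; first exact: bounded_adjoint.
by rewrite -oppr0; apply/homog_low/homog_adjoint.
Qed.

Lemma row_alpha_homog c : (forall j, constant_op oo (c j)) ->
  bounded_op (row_alpha alpha c) /\ homog (-1) (row_alpha alpha c).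
Proof.
move=> cc; have bc j : bounded_op (c j) by have /constant_opE[] := cc j.
split; first by apply: bounded_sum => j; apply: bounded_comp => //; exact: bounded_word.
move=> t u tu; rewrite /row_alpha op_sum ell2_sum big1// => j _.
have /constant_opE[_ hc] := cc j.
have h := homog_comp (bc j) (bounded_word [:: j]) hc (@homog_word [:: j]).
by apply: h; rewrite addr0.
Qed.

Lemma op_ball_geometric c : op_ball oo alpha c -> geometric_op (row_alpha alpha c).
Proof.
move=> [cc [l l1 lim]]; have [bB hB] := row_alpha_homog cc.
exact: geometric_of_limit lim.
Qed.

Lemma point_evalE S c : bounded_op S -> op_ball oo alpha c ->
  point_eval oo alpha S c = degree_part 0 (neumann (row_alpha alpha c) \o S).
Proof.
move=> bS /op_ball_geometric gc; rewrite -(point_eval_series gc bS) /point_eval.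
by congr op_series; apply/funext => n; rewrite sum_coefE.
Qed.

Lemma szegoE d : op_ball oo alpha d ->
  szego alpha d = adjoint (neumann (row_alpha alpha d)).
Proof. by move=> /op_ball_geometric gd; rewrite /szego (op_inv_adjoint gd). Qed.

Lemma schur_kernelE (s : ('I_q -> oper) -> oper) c d : (forall c, op_ball oo alpha c -> constant_op oo (s c)) ->
  op_ball oo alpha c -> op_ball oo alpha d ->
  schur_kernel alpha s c d = degree_part 0 (neumann (row_alpha alpha c) \o
    (idfun - (s c \o adjoint (s d))) \o adjoint (neumann (row_alpha alpha d))).
Proof.
move=> sc bc bd; have /constant_opE[b1 h1] := sc c bc.
have /constant_opE[b2 h2] := sc d bd; have b2a := bounded_adjoint b2.
apply: kernel_series; [exact: op_ball_geometric|exact: op_ball_geometric| |].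
  by apply: bounded_sub; [exact: bounded_id|exact: bounded_comp].
apply: homog_sub; first exact: homog_id.
rewrite -[X in homog X]addr0; apply: homog_comp => //.
by rewrite -oppr0; exact: homog_adjoint.
Qed.

Lemma schur_kernel_multiplier S (s : ('I_q -> oper) -> oper) : schur_multiplier oo S ->
  (forall c, op_ball oo alpha c -> constant_op oo (s c)) ->
  (forall c, op_ball oo alpha c -> s c = point_eval oo alpha S c) ->
  forall c d, op_ball oo alpha c -> op_ball oo alpha d ->
  schur_kernel alpha s c d = point_eval oo alpha (multiplier_kernel oo alpha S d) c.
Proof.
move=> [/causalE[bS lS] _] sconst sE c d bc bd.
have gc := op_ball_geometric bc; have gd := op_ball_geometric bd.
have /constant_opE[b2 h2] := sconst d bd.
rewrite point_evalE//; last first.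
  rewrite /multiplier_kernel szegoE// -sE//.
  apply: bounded_comp; last exact/bounded_adjoint/(bounded_neumann gd).
  apply: bounded_sub; first exact: bounded_id.
  by apply: bounded_comp => //; exact: bounded_adjoint.
rewrite schur_kernelE// /multiplier_kernel szegoE// -sE//.
by rewrite [s c]sE// point_evalE// kernel_identity.
Qed.

(** For vectors on one level the kernel is a difference of two Gram
    matrices. *)
Lemma kernel_quadratic (s : ('I_q -> oper) -> oper) (I : finType) (c : I -> 'I_q -> oper) (x : I -> ell2) n :
  (forall c, op_ball oo alpha c -> constant_op oo (s c)) ->
  (forall i, op_ball oo alpha (c i)) -> (forall i, supp_at n (x i)) ->
  \sum_i \sum_j inner (schur_kernel alpha s (c i) (c j) (x j)) (x i) =
  (l2norm (\sum_i adjoint (neumann (row_alpha alpha (c i))) (x i)) ^+ 2 -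
   l2norm (\sum_i adjoint (s (c i))
     (adjoint (neumann (row_alpha alpha (c i))) (x i))) ^+ 2)%:C%C.
Proof.
move=> sc bc xn; rewrite rmorphB /= -!inner_self !inner_suml.
rewrite -sumrB exchange_big /=; apply: eq_bigr => j _.
rewrite !inner_sumr -sumrB; apply: eq_bigr => i _.
have gi := op_ball_geometric (bc i); have gj := op_ball_geometric (bc j).
have /constant_opE[bsi hsi] := sc _ (bc i); have /constant_opE[bsj hsj] := sc _ (bc j).
have bNi := bounded_neumann gi; have bNj := bounded_neumann gj.
have bsja := bounded_adjoint bsj; have bNja := bounded_adjoint bNj.
have bG : bounded_op (idfun - (s (c i) \o adjoint (s (c j)))).
  by apply: bounded_sub; [exact: bounded_id|exact: bounded_comp].
rewrite schur_kernelE//; set Y := (X in degree_part 0 X).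
have bY : bounded_op Y by do 2![apply: bounded_comp => //].
have -> : inner (degree_part 0 Y (x j)) (x i) = inner (Y (x j)) (x i).
  apply/eqP; rewrite -subr_eq0 -innerBl; apply/eqP/inner_disjoint => t.
  have [tn|tn] := eqVneq (lev t) n; last by right; exact: xn.
  by left; rewrite ell2B (degree_part_val _ _ bY (xn j)) addr0 tn eqxx subrr.
rewrite /Y /= -inner_adjr// opB innerBl; congr (_ - _).
by rewrite /= -inner_adjr.
Qed.

End leveled.
(** * A Schur multiplier gives a positive kernel *)

Section necessity.
Variables (R : realType) (T : choiceType) (oo : set (nat -> T)).
Variables (lev : T -> int) (par : T -> T).
Variables (q : nat) (alpha : 'I_q -> T -> T).
Hypothesis lev_preceq : forall s t, preceq oo s t <-> lev s <= lev t.
Hypothesis lev_asymp : forall s t, asymp oo s t <-> lev s = lev t.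
Hypothesis lev_par : forall t, lev (par t) = lev t - 1.
Hypothesis par_alpha : forall j t, par (alpha j t) = t.
Hypothesis alpha_par : forall t, exists j, alpha j (par t) = t.
Hypothesis alpha_injective : forall t, injective (alpha ^~ t).

Local Notation C := (complex R).
Local Notation normc := (@ComplexField.Normc.normc R).
Local Notation ell2 := (ell2 R T).
Local Notation oper := (oper R T).
Local Notation chi := (chi R).
Local Notation supp_at := (supp_at lev).
Implicit Types (f g h x : ell2) (A B D F G N S : oper) (c d : 'I_q -> oper).

Lemma has_sum_sum (I : Type) (s : seq I) (F : I -> T -> C) (l : I -> C) :
  (forall i, has_sum (F i) (l i)) ->
  has_sum (fun t => \sum_(i <- s) F i t) (\sum_(i <- s) l i).
Proof.
move=> Fl; elim: s => [|i s IHs].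
  rewrite big_nil => eps e0; exists [::] => // u _ _; rewrite big1 => [|t _].
    by rewrite subr0 ComplexField.Normc.normc0 ltW.
  by rewrite big_nil.
rewrite big_cons; apply: eq_has_sum (has_sumD (Fl i) IHs) => t.
by rewrite big_cons.
Qed.

Lemma hs_bounded F : bounded_op F -> hilbert_schmidt F ->
  exists M, forall s, uniq s -> \sum_(t <- s) l2norm (F (chi t)) ^+ 2 <= M.
Proof.
move=> bF; rewrite /hilbert_schmidt.
have tE t : complex.Re (inner ((adjoint F \o F) (chi t)) (chi t)) = l2norm (F (chi t)) ^+ 2.
  by rewrite l2norm_sqrE; congr complex.Re; exact: inner_adjl.
under eq_esum do rewrite tE.
set v := esum _ _ => vfin.
have v0 : (0 <= v)%E by apply: esum_ge0 => t _; rewrite lee_fin sqr_ge0.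
exists (fine v) => s us; rewrite -lee_fin fineK ?ge0_fin_numE//.
apply: esum_ge; exists [set` s]; first by split => //; exact: finite_seq.
by rewrite -fsbig_seq// sumEFin.
Qed.

Lemma inner_adjoint_comp F G t : bounded_op G ->
  inner ((adjoint G \o F) (chi t)) (chi t) = inner (F (chi t)) (G (chi t)).
Proof. by move=> bG; rewrite /= inner_adjl. Qed.

Lemma has_sum_hs_inner A F G : bounded_op A -> bounded_op F -> bounded_op G ->
  hilbert_schmidt F -> hilbert_schmidt G ->
  has_sum (fun t => inner (A (F (chi t))) (G (chi t))) (hs_inner (A \o F) G).
Proof.
move=> bA bF bG /(hs_bounded bF)[M1 h1] /(hs_bounded bG)[M2 h2].
rewrite (_ : (fun t => _) =
  (fun t => inner ((adjoint G \o (A \o F)) (chi t)) (chi t))); last first.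
  by apply/funext => t; rewrite inner_adjoint_comp.
apply: (@has_sum_csum _ _ _ (opnorm A * ((M1 + M2) / 2))) => s us.
apply: (@le_trans _ _ (\sum_(t <- s) opnorm A *
    ((l2norm (F (chi t)) ^+ 2 + l2norm (G (chi t)) ^+ 2) / 2))).
  apply: ler_sum => t _; rewrite inner_adjoint_comp// (le_trans (cauchy_schwarz _ _))//.
  rewrite (le_trans (ler_wpM2r (l2norm_ge0 _) (opnorm_ub _ bA)))// -mulrA.
  rewrite ler_wpM2l ?opnorm_ge0//.
  by have := sqr_ge0 (l2norm (F (chi t)) - l2norm (G (chi t))); rewrite sqrrB; lra.
rewrite -mulr_sumr ler_wpM2l ?opnorm_ge0// -mulr_suml ler_wpM2r ?invr_ge0//.
by rewrite big_split/= lerD ?h1 ?h2.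
Qed.

Lemma l2norm_mono f g : (forall t, normc (f t) <= normc (g t)) -> l2norm f <= l2norm g.
Proof.
move=> fg; apply: l2norm_le; first exact: l2norm_ge0.
move=> s us; apply: le_trans (l2norm_bound g us); apply: ler_sum => t _.
by rewrite lerXn2r ?nnegrE ?normc_ge0.
Qed.

(** On one level, the vectors [adjoint (s c) phi] are the part below that
    level of [adjoint S phi], so the contractivity of [S] bounds the second
    Gram matrix by the first. *)
Lemma multiplier_contractive S (s : ('I_q -> oper) -> oper) (I : finType)
    (c : I -> 'I_q -> oper) (x : I -> ell2) n :
  schur_multiplier oo S ->
  (forall c, op_ball oo alpha c -> s c = point_eval oo alpha S c) ->
  (forall i, op_ball oo alpha (c i)) -> (forall i, supp_at n (x i)) ->
  l2norm (\sum_i adjoint (s (c i)) (adjoint (neumann (row_alpha alpha (c i))) (x i)))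
  <= l2norm (\sum_i adjoint (neumann (row_alpha alpha (c i))) (x i)).
Proof.
move=> [/(causalE lev_preceq)[bS lS] S1] sE bc xn.
set Phi := (X in _ <= l2norm X).
have bSa := bounded_adjoint bS.
apply: (@le_trans _ _ (l2norm (adjoint S Phi))); last first.
  rewrite (le_trans (opnorm_ub _ bSa))// ler_piMl ?l2norm_ge0//.
  exact: le_trans (opnorm_adjoint bS) S1.
have gc i := op_ball_geometric lev_preceq lev_par par_alpha (bc i).
have scE i : s (c i) = degree_part lev 0 (neumann (row_alpha alpha (c i)) \o S).
  by rewrite sE// (point_evalE lev_preceq lev_asymp lev_par par_alpha alpha_par).
apply: l2norm_mono => u; rewrite ell2_sum.
have [nu|un] := leP n (lev u).
  rewrite /Phi lin_sum; last exact: bounded_lin.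
  rewrite ell2_sum [leLHS](_ : _ = normc (\sum_i
    adjoint S (adjoint (neumann (row_alpha alpha (c i))) (x i)) u)) //.
  congr normc; apply: eq_bigr => i _; rewrite scE.
  by rewrite (adjoint_eval_agree (gc i) bS lS (xn i)).
rewrite big1 ?ComplexField.Normc.normc0 ?normc_ge0// => i _; rewrite scE.
by rewrite (adjoint_eval_supp (gc i) bS (xn i)).
Qed.

Lemma multiplier_positive_kernel S (s : ('I_q -> oper) -> oper) :
  (forall c, op_ball oo alpha c -> constant_op oo (s c)) ->
  schur_multiplier oo S ->
  (forall c, op_ball oo alpha c -> s c = point_eval oo alpha S c) ->
  positive_kernel oo alpha (schur_kernel alpha s).
Proof.
move=> sc sS sE m c k bc kC2.
have bk i : bounded_op (k i) by case: (kC2 i) => [/(constant_opE lev_preceq)[]].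
have hk i t : supp_at (lev t) (k i (chi t)).
  have [/(constant_opE lev_preceq)[_ h] _] := kC2 i.
  by rewrite -[lev t]addr0; apply: (homog_supp (bk i) h); exact: supp_at_chi.
have hsk i : hilbert_schmidt (k i) by case: (kC2 i) => _ [].
have bK i j : bounded_op (schur_kernel alpha s (c i) (c j)).
  rewrite (schur_kernelE lev_preceq lev_par par_alpha)//.
  have /(constant_opE lev_preceq)[bi _] := sc _ (bc i).
  have /(constant_opE lev_preceq)[bj _] := sc _ (bc j).
  have gi := op_ball_geometric lev_preceq lev_par par_alpha (bc i).
  have gj := op_ball_geometric lev_preceq lev_par par_alpha (bc j).
  have bja := bounded_adjoint bj.
  apply: bounded_degree_part; apply: bounded_comp; last first.
    exact/bounded_adjoint/(bounded_neumann gj).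
  apply: bounded_comp; first exact: (bounded_neumann gi).
  by apply: bounded_sub; [exact: bounded_id|exact: bounded_comp].
apply: (@has_sum_ge0 _ _ (fun t => \sum_i \sum_j
  inner (schur_kernel alpha s (c i) (c j) (k j (chi t))) (k i (chi t)))).
  move=> t; rewrite (kernel_quadratic lev_preceq lev_par par_alpha sc bc (fun i => hk i t)).
  rewrite ler0c subr_ge0 lerXn2r ?nnegrE ?l2norm_ge0//.
  exact: (multiplier_contractive sS sE bc (fun i => hk i t)).
apply: has_sum_sum => i; apply: has_sum_sum => j.
exact: has_sum_hs_inner.
Qed.

End necessity.
(** * A positive kernel gives a Schur multiplier *)

Section sufficiency.
Variables (R : realType) (T : choiceType) (oo : set (nat -> T)).
Variables (lev : T -> int) (par : T -> T).
Variables (q : nat) (alpha : 'I_q -> T -> T).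
Hypothesis lev_preceq : forall s t, preceq oo s t <-> lev s <= lev t.
Hypothesis lev_asymp : forall s t, asymp oo s t <-> lev s = lev t.
Hypothesis lev_par : forall t, lev (par t) = lev t - 1.
Hypothesis par_alpha : forall j t, par (alpha j t) = t.
Hypothesis alpha_par : forall t, exists j, alpha j (par t) = t.
Hypothesis alpha_injective : forall t, injective (alpha ^~ t).

Local Notation C := (complex R).
Local Notation normc := (@ComplexField.Normc.normc R).
Local Notation ell2 := (ell2 R T).
Local Notation oper := (oper R T).
Local Notation chi := (chi R).
Local Notation supp_at := (supp_at lev).
Local Notation supp_ge := (supp_ge lev).
Local Notation homog := (homog lev).
Local Notation ball := (op_ball oo alpha).
Local Notation geometric_op := (geometric_op lev).
Implicit Types (f g h x : ell2) (A B D F G N : oper) (c d : 'I_q -> oper).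

Definition indicator_op (P : pred T) : oper :=
  fun f => insubd 0 (fun u => if P u then f u else 0).

Lemma indicator_opE P f u : indicator_op P f u = if P u then f u else 0.
Proof.
rewrite /indicator_op insubdK//; apply: (@in_l2 _ _ _ (l2norm f ^+ 2)) => s us.
apply: le_trans (l2norm_bound f us); apply: ler_sum => t _; case: ifP => // _.
by rewrite ComplexField.Normc.normc0 expr0n sqr_ge0.
Qed.

Lemma bounded_indicator P : bounded_op (indicator_op P).
Proof.
apply: (@bounded_opI _ _ _ 1) => [a f g|f].
  apply: ell2P => t; rewrite ell2D ell2Z !indicator_opE.
  by case: ifP => // _; rewrite mulr0 addr0.
rewrite mul1r; apply: l2norm_mono => u; rewrite indicator_opE; case: ifP => // _.
by rewrite ComplexField.Normc.normc0 normc_ge0.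
Qed.

Lemma constant_indicator P : constant_op oo (indicator_op P).
Proof.
apply/(constant_opE lev_preceq); split; first exact: bounded_indicator.
move=> t u; rewrite addr0 indicator_opE chiE => tu; case: ifP => // _.
by case: (eqVneq u t) tu => // ->; rewrite eqxx.
Qed.

(** The row for which [row_alpha] sends [chi t] to [chi (par t)] when [t] is
    in [E] and to 0 otherwise. *)
Definition climb (E : pred T) (j : 'I_q) : oper := indicator_op (fun u => E (alpha j u)).

Lemma climb_chi E t :
  row_alpha alpha (climb E) (chi t) = if E t then chi (par t) else 0.
Proof.
apply: ell2P => u; rewrite /row_alpha op_sum ell2_sum.
have val j : (climb E j \o word_op alpha [:: j]) (chi t) u =
    if (alpha j u == t) && E t then 1 else 0.
  rewrite /= indicator_opE (word_opE par_alpha) chiE /=.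
  by case: eqVneq => [->|_] /=; case: ifP.
rewrite (eq_bigr _ (fun j _ => val j)); case: ifP => Et; last first.
  by rewrite ell20 big1// => j _; rewrite andbF.
rewrite chiE; have [->|ne] := eqVneq u (par t).
  have [j jt] := alpha_par t; rewrite (bigD1 j)//= jt eqxx /= big1 ?addr0// => i ij.
  rewrite andbT; case: eqP => // it; case/eqP: ij.
  by apply: (@alpha_injective (par t)); rewrite it jt.
rewrite big1// => j _; case: eqP => //= jt; case/eqP: ne.
by rewrite -jt par_alpha.
Qed.

Definition ancestors t k : pred T := fun v => v \in traject par t k.

Lemma ancestorsP t k v : reflect (exists2 i, (i < k)%N & v = iter i par t)
  (ancestors t k v).
Proof. exact: trajectP. Qed.

Definition chain_row t k := climb (ancestors t k).

Lemma iter_chain_row t k n v : lev v <= lev t - k%:Z + n%:Z ->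
  iter n.+1 (row_alpha alpha (chain_row t k)) (chi v) = 0.
Proof.
have bc := row_alpha_homog lev_preceq lev_par par_alpha
  (fun j => constant_indicator (fun u => ancestors t k (alpha j u))).
elim: n v => [|n IHn] v vt.
  rewrite /= climb_chi; case: ifP => // /ancestorsP[i ik E]; move: vt.
  by rewrite E (lev_iter_par lev_par); lia.
rewrite iterSr climb_chi; case: ifP => _; last first.
  by apply: lin0; apply: bounded_lin; apply: bounded_iter; exact: bc.1.
by apply: IHn; rewrite lev_par; lia.
Qed.

(** The chain operator is nilpotent, so its spectral radius is 0. *)
Lemma ball_chain_row t k : ball (chain_row t k).
Proof.
split=> [j|]; first exact: constant_indicator.
have bc := row_alpha_homog lev_preceq lev_par par_alpha
  (fun j => constant_indicator (fun u => ancestors t k (alpha j u))).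
have bi n := bounded_iter n bc.1.
have nil n : (k < n)%N -> iter n (row_alpha alpha (chain_row t k)) = 0.
  case: n => // n kn; apply: op_entryP; [exact: bi|exact: bounded_0|] => v u.
  have [vt|tv] := leP (lev v) (lev t).
    by rewrite iter_chain_row ?op0//; lia.
  rewrite iterSr climb_chi ifF ?(lin0 (bounded_lin (bi n)))//.
  apply/negP => /ancestorsP[i _ E]; move: tv.
  by rewrite E (lev_iter_par lev_par); lia.
exists 0 => //; apply: cvg_near_cst; exists k.+1 => // n /= kn.
rewrite nil//; have -> : opnorm (0 : oper) = 0.
  apply/eqP; rewrite eq_le opnorm_ge0 ?andbT; last exact: bounded_0.
  by apply: opnorm_le => // f; rewrite op0 l2norm0 mul0r.
by rewrite powR0// invr_eq0 pnatr_eq0; lia.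
Qed.

Definition chain t k : ell2 := \sum_(0 <= l < k.+1) chi (iter l par t).

(** The adjoint of the chain operator moves each node of the chain one step
    down towards [t], so it removes the top summand from a chain sum; that is,
    [idfun] minus this adjoint maps the chain to its top node. *)
Lemma adjoint_neumann_chain t k i : (i <= k)%N ->
  adjoint (neumann (row_alpha alpha (chain_row t k))) (chi (iter i par t)) = chain t i.
Proof.
move=> ik; set B := row_alpha _ _.
have gB : geometric_op B.
  exact: (op_ball_geometric lev_preceq lev_par par_alpha (ball_chain_row t k)).
have [bB _ _] := gB; have [bN _ e1 _] := neumann_spec gB.
have lev_it := lev_iter_par lev_par.
have Bchi l : (l <= k)%N -> adjoint B (chi (iter l par t)) =
    if l is l'.+1 then chi (iter l' par t) else 0.
  move=> lk; apply: ell2P => v; rewrite adjoint_entry// /B climb_chi.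
  case: l lk => [_|l lk].
    rewrite ell20; case: ifP => [/ancestorsP[j _ ->]|_]; last by rewrite ell20 conjC0.
    rewrite chiE; case: eqVneq => [/(congr1 lev)|_]; last by rewrite conjC0.
    by rewrite lev_par !lev_it; lia.
  rewrite chiE; have [->|ne] := eqVneq v (iter l par t).
    by rewrite ifT ?chiE ?eqxx ?conjC1//; apply/ancestorsP; exists l.
  case: ifP => [/ancestorsP[j _ E]|_]; last by rewrite ell20 conjC0.
  rewrite chiE; case: eqVneq => [E'|_]; last by rewrite conjC0.
  case/eqP: ne; rewrite E; congr (iter _ _ _); move/(congr1 lev): E'.
  by rewrite E lev_par !lev_it; lia.
have Bchain : adjoint B (chain t i) = chain t i - chi (iter i par t).
  rewrite {2}/chain big_nat_recr//= addrK /chain lin_sum; last first.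
    by apply: bounded_lin; exact: bounded_adjoint.
  rewrite big_nat_recl//= (Bchi 0%N)// add0r big_nat [RHS]big_nat.
  by apply: eq_bigr => l /andP[_ li]; rewrite -[par (iter l par t)]/(iter l.+1 par t) Bchi//; lia.
have := congr1 (fun X : oper => adjoint X (chain t i)) e1.
have bI := @bounded_id R T; have bIB := bounded_sub bI bB.
rewrite adjoint_comp// adjoint_sub// adjoint_id /= opB Bchain => <-.
by congr (adjoint _ _); rewrite opprB addrC subrK.
Qed.

Variable s : ('I_q -> oper) -> oper.
Hypothesis s_const : forall c, ball c -> constant_op oo (s c).
Hypothesis s_pos : positive_kernel oo alpha (schur_kernel alpha s).

Local Notation szego_vec c x := (adjoint (neumann (row_alpha alpha c)) x).

Definition rank_one (t0 : T) x : oper := fun f => f t0 *: x.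

Lemma bounded_rank_one t0 x : bounded_op (rank_one t0 x).
Proof.
apply: (@bounded_opI _ _ _ (l2norm x)) => [a f g|f].
  by rewrite /rank_one ell2D ell2Z scalerDl scalerA.
by rewrite /rank_one l2normZ mulrC ler_wpM2l ?l2norm_ge0// normc_le_l2norm.
Qed.

Lemma rank_one_chi t0 x t : rank_one t0 x (chi t) = (t0 == t)%:R *: x.
Proof. by []. Qed.

(** Such an operator sends the single basis vector at [t0] to a vector on its
    own level. *)
Lemma C2_rank_one t0 x : supp_at (lev t0) x -> C2 oo (rank_one t0 x).
Proof.
move=> xt; have bk := bounded_rank_one t0 x.
have hk : homog 0 (rank_one t0 x).
  move=> t u; rewrite addr0 rank_one_chi ell2Z => tu.
  have [E|_] := eqVneq t0 t; last by rewrite mul0r.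
  by rewrite xt ?mulr0// E.
have ck : constant_op oo (rank_one t0 x) by apply/(constant_opE lev_preceq).
split => //; split; first by case: ck.
rewrite /hilbert_schmidt.
rewrite (eq_esum (b := fun t => (if t == t0 then l2norm x ^+ 2 else 0)%:E)); last first.
  move=> t _; congr (_%:E); rewrite inner_adjoint_comp// -l2norm_sqrE rank_one_chi.
  rewrite eq_sym; case: eqVneq => _; first by rewrite scale1r.
  by rewrite scale0r l2norm0 expr0n.
have [t|u uu|v [-> _ _ _]] := @esum_bounded R T
    (fun t => if t == t0 then l2norm x ^+ 2 else 0) (l2norm x ^+ 2) _ _.
- by case: ifP => // _; exact: sqr_ge0.
- rewrite -big_mkcond /= -big_filter.
  have [tu|tu] := boolP (t0 \in u).
    by rewrite filter_pred1_uniq// big_seq1.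
  rewrite (_ : [seq _ <- _ | _] = [::]) ?big_nil ?sqr_ge0//.
  apply/eqP; rewrite -(negbK (_ == _)) -has_filter; apply/hasP => -[y yu /eqP yt].
  by rewrite -yt yu in tu.
- by rewrite ltry.
Qed.

Lemma csum_single (F : T -> C) t0 : (forall t, t != t0 -> F t = 0) -> csum F = F t0.
Proof.
move=> F0; apply: (@has_sumE _ _ _ (normc (F t0))).
  move=> u uu; have [tu|tu] := boolP (t0 \in u).
    rewrite (bigD1_seq t0)//= big1 ?addr0// => t tt0.
    by rewrite F0// ComplexField.Normc.normc0.
  rewrite big1_seq ?normc_ge0// => t /andP[_ tin].
  by rewrite F0 ?ComplexField.Normc.normc0//; apply: contraNneq tu => <-.
have := @has_sum_fin _ _ F [:: t0] isT; rewrite big_seq1; apply => t.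
by rewrite inE => /F0.
Qed.

(** For rank one operators from the basis vector at [t0] to the [x i], each
    trace in the positivity condition has a single nonzero term. *)
Lemma positive_kernel_contractive m (c : 'I_m -> 'I_q -> oper) (x : 'I_m -> ell2) t0 :
  (forall i, ball (c i)) -> (forall i, supp_at (lev t0) (x i)) ->
  l2norm (\sum_i adjoint (s (c i)) (szego_vec (c i) (x i))) <=
  l2norm (\sum_i szego_vec (c i) (x i)).
Proof.
case: m c x => [|m] c x bc xt; first by rewrite !big_ord0.
have := s_pos bc (fun i => C2_rank_one (xt i)).
have -> : \sum_i \sum_j hs_inner (schur_kernel alpha s (c i) (c j) \o
      rank_one t0 (x j)) (rank_one t0 (x i)) =
    \sum_i \sum_j inner (schur_kernel alpha s (c i) (c j) (x j)) (x i).
  apply: eq_bigr => i _; apply: eq_bigr => j _.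
  have br := bounded_rank_one t0.
  have bK : bounded_op (schur_kernel alpha s (c i) (c j)).
    rewrite (schur_kernelE lev_preceq lev_par par_alpha)//.
    have /(constant_opE lev_preceq)[bi _] := s_const (bc i).
    have /(constant_opE lev_preceq)[bj _] := s_const (bc j).
    have gi := op_ball_geometric lev_preceq lev_par par_alpha (bc i).
    have gj := op_ball_geometric lev_preceq lev_par par_alpha (bc j).
    have bja := bounded_adjoint bj.
    apply: bounded_degree_part; apply: bounded_comp; last first.
      exact/bounded_adjoint/(bounded_neumann gj).
    apply: bounded_comp; first exact: (bounded_neumann gi).
    by apply: bounded_sub; [exact: bounded_id|exact: bounded_comp].
  rewrite /hs_inner /op_trace (@csum_single _ t0) => [|t tt0]; rewrite inner_adjoint_comp//.
    by rewrite /= !rank_one_chi eqxx !scale1r.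
  by rewrite [X in inner _ X]rank_one_chi eq_sym (negPf tt0) scale0r inner0r.
rewrite (kernel_quadratic lev_preceq lev_par par_alpha s_const bc xt).
by rewrite ler0c subr_ge0 ler_sqr ?nnegrE ?l2norm_ge0.
Qed.

Lemma bounded_szego c : ball c -> bounded_op (adjoint (neumann (row_alpha alpha c))).
Proof.
move=> bc; apply: bounded_adjoint.
exact: (bounded_neumann (op_ball_geometric lev_preceq lev_par par_alpha bc)).
Qed.

Lemma adjoint_value c : ball c ->
  bounded_op (adjoint (s c)) /\ homog 0 (adjoint (s c)).
Proof.
move=> /s_const/(constant_opE lev_preceq)[bsc hsc]; split; first exact: bounded_adjoint.
by rewrite -oppr0; exact: homog_adjoint.
Qed.

(** The linear relation spanned by the pairs that the compression of the
    adjoint of the multiplier to the levels from [n] on has to relate. *)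
Definition graph (n : int) f g := exists m (c : 'I_m -> 'I_q -> oper) (x : 'I_m -> ell2),
  [/\ forall i, ball (c i), forall i, supp_at n (x i),
      f = \sum_i szego_vec (c i) (x i) &
      g = \sum_i adjoint (s (c i)) (szego_vec (c i) (x i))].

Lemma graph_generator n c x : ball c -> supp_at n x ->
  graph n (szego_vec c x) (adjoint (s c) (szego_vec c x)).
Proof.
by move=> bc xn; exists 1%N, (fun=> c), (fun=> x); split => //; rewrite big_ord1.
Qed.

Lemma graph0 n : graph n 0 0.
Proof.
exists 0%N, (fun=> fun=> 0), (fun=> 0).
by split; [case|case| |]; rewrite ?big_ord0.
Qed.

Lemma graphD n f g f' g' : graph n f g -> graph n f' g' -> graph n (f + f') (g + g').
Proof.
move=> [m [c [x [bc xn -> ->]]]] [m' [c' [x' [bc' xn' -> ->]]]].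
pose cc (i : 'I_(m + m')) := match fintype.split i with inl j => c j | inr j => c' j end.
pose xx (i : 'I_(m + m')) := match fintype.split i with inl j => x j | inr j => x' j end.
exists (m + m')%N, cc, xx.
have sl (j : 'I_m) : fintype.split (lshift m' j) = inl j := unsplitK (inl j).
have sr (j : 'I_m') : fintype.split (rshift m j) = inr j := unsplitK (inr j).
split.
- by move=> i; rewrite /cc; case: (fintype.split i).
- by move=> i; rewrite /xx; case: (fintype.split i).
- rewrite big_split_ord /=.
  by congr (_ + _); apply: eq_bigr => j _; rewrite /cc /xx ?sl ?sr.
- rewrite big_split_ord /=.
  by congr (_ + _); apply: eq_bigr => j _; rewrite /cc /xx ?sl ?sr.
Qed.

Lemma graphZ n a f g : graph n f g -> graph n (a *: f) (a *: g).
Proof.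
move=> [m [c [x [bc xn -> ->]]]]; exists m, c, (fun i => a *: x i); split => //.
- by move=> i t tn; rewrite ell2Z xn ?mulr0.
- rewrite scaler_sumr; apply: eq_bigr => i _.
  by rewrite linZ//; apply: bounded_lin; exact: bounded_szego.
- rewrite scaler_sumr; apply: eq_bigr => i _.
  rewrite [in RHS]linZ; last by apply: bounded_lin; exact: bounded_szego.
  by rewrite linZ//; apply: bounded_lin; case: (adjoint_value (bc i)).
Qed.

Lemma graph_sum n (v : seq T) (F G : T -> ell2) :
  (forall t, t \in v -> graph n (F t) (G t)) ->
  graph n (\sum_(t <- v) F t) (\sum_(t <- v) G t).
Proof.
elim: v => [|t v IHv] FG; first by rewrite !big_nil; exact: graph0.
rewrite !big_cons; apply: graphD; first by apply: FG; rewrite mem_head.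
by apply: IHv => u uv; apply: FG; rewrite inE uv orbT.
Qed.

Lemma graph_le t0 f g : graph (lev t0) f g -> l2norm g <= l2norm f.
Proof.
by move=> [m [c [x [bc xn -> ->]]]]; exact: positive_kernel_contractive xn.
Qed.

(** Contractivity makes the linear relation single-valued. *)
Lemma graph_unique t0 f g g' : graph (lev t0) f g -> graph (lev t0) f g' -> g = g'.
Proof.
move=> fg /(graphZ (-1)) fg'; have := graph_le (graphD fg fg').
rewrite !scaleN1r subrr l2norm0 => h; apply/subr0_eq/l2norm0_eq0/eqP.
by rewrite eq_le h l2norm_ge0.
Qed.

(** [column t k] is the part on the levels from [lev t - k] on of the column
    at [t] of the adjoint of the multiplier: [chi t] is the difference of two
    chains, whose images are prescribed. *)
Definition chain_image t k := adjoint (s (chain_row t k)) (chain t k).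

Definition column t k : ell2 :=
  chain_image t k - (if k is k'.+1 then chain_image (par t) k' else 0).

Lemma graph_chain t k : graph (lev (iter k par t)) (chain t k) (chain_image t k).
Proof.
have := graph_generator (ball_chain_row t k) (@supp_at_chi R T lev (iter k par t)).
by rewrite adjoint_neumann_chain.
Qed.

Lemma graph_column t k : graph (lev (iter k par t)) (chi t) (column t k).
Proof.
have gN n f g : graph n f g -> graph n (- f) (- g).
  by rewrite -(scaleN1r f) -(scaleN1r g); exact: graphZ.
case: k => [|k].
  have := graph_chain t 0.
  by rewrite /column subr0 /chain big_nat1.
have -> : chi t = chain t k.+1 - chain (par t) k.
  rewrite /chain big_nat_recl// -addrA [X in _ + X](_ : _ = 0) ?addr0//.
  apply/eqP; rewrite subr_eq0; apply/eqP; apply: eq_bigr => l _.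
  by rewrite -iterSr.
apply: graphD (graph_chain t k.+1) (gN _ _ _ _).
by rewrite iterSr; exact: graph_chain.
Qed.

(** The row of the longer chain also evaluates the shorter chain, with the same
    image by [graph_unique]; the extra top node only contributes on its own
    level, as [s] takes constant values. *)
Lemma chain_image_stable t k u : lev t - k%:Z <= lev u ->
  chain_image t k.+1 u = chain_image t k u.
Proof.
move=> tu; have bc := ball_chain_row t k.+1; have [bS hS] := adjoint_value bc.
have := graph_generator bc (@supp_at_chi R T lev (iter k par t)).
rewrite adjoint_neumann_chain// => /graph_unique /(_ (graph_chain t k)) <-.
apply: (homog_local bS hS) => v; rewrite addr0 => vu.
rewrite /chain big_nat_recr//= ell2D chiE; case: eqVneq => [E|_]; last by rewrite addr0.
by move: tu; rewrite -vu E lev_par (lev_iter_par lev_par); lia.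
Qed.

Lemma column_stableS t k u : lev t - k%:Z <= lev u -> column t k.+1 u = column t k u.
Proof.
move=> tu; rewrite /column !ell2B chain_image_stable//; congr (_ - _).
case: k tu => [|k] tu; last by rewrite chain_image_stable// lev_par; lia.
have [bS hS] := adjoint_value (ball_chain_row (par t) 0).
rewrite ell20; apply: (homog_supp bS hS (m := lev t - 1)); last by lia.
by rewrite /chain big_nat1 -lev_par; exact: supp_at_chi.
Qed.

Lemma column_stable t k k' u : lev t - k%:Z <= lev u -> lev t - k'%:Z <= lev u ->
  column t k u = column t k' u.
Proof.
have up i j : lev t - i%:Z <= lev u -> column t (j + i) u = column t i u.
  by move=> tu; elim: j => // j IHj; rewrite addSn column_stableS ?IHj//; lia.
by move=> ku k'u; rewrite -(up k k' ku) -(up k' k k'u) addnC.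
Qed.

Definition adjoint_entry_of u t : C := column t `|lev t - lev u|%N u.

Lemma columnE t k u : lev t - k%:Z <= lev u -> column t k u = adjoint_entry_of u t.
Proof. by move=> tu; apply: column_stable => //; lia. Qed.

Lemma adjoint_entry_upper u t : lev t < lev u -> adjoint_entry_of u t = 0.
Proof.
move=> tu; rewrite -(@columnE t 0); last by lia.
rewrite /column subr0; have [bS hS] := adjoint_value (ball_chain_row t 0).
apply: (homog_supp bS hS (m := lev t)); last by lia.
by rewrite /chain big_nat1; exact: supp_at_chi.
Qed.

(** A finite section involves finitely many levels, so it is a section of a
    contraction [graph n] with [n] below all of them. *)
Lemma adjoint_multiplier_exists : exists X : oper, [/\ bounded_op X,
  forall f, l2norm (X f) <= l2norm f &
  forall t u, X (chi t) u = adjoint_entry_of u t].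
Proof.
have [||X [bX X1 XE]] := @matrix_op R T adjoint_entry_of 1 => //; last first.
  by exists X; split => // f; rewrite -[leRHS]mul1r.
move=> v r a uv ur; rewrite expr1n mul1r.
case: v uv => [|t0 v0] uv.
  rewrite big_nil big1// => u _.
  by rewrite big_nil ComplexField.Normc.normc0 expr0n.
set v := t0 :: v0 in uv *.
pose L := (\max_(t <- v ++ r) `|lev t|)%N.
have Lb t : t \in v ++ r -> (`|lev t| <= L)%N.
  by move=> tv; exact: (@leq_bigmax_seq _ _ xpredT (fun t => `|lev t|%N) t tv isT).
have Lv t : t \in v -> - L%:Z <= lev t.
  by move=> tv; have := Lb t; rewrite mem_cat tv => /(_ isT); lia.
have Lr u : u \in r -> - L%:Z <= lev u.
  by move=> ur'; have := Lb u; rewrite mem_cat ur' orbT => /(_ isT); lia.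
pose k t := absz (lev t + L%:Z)%R.
have kE t : t \in v -> lev (iter (k t) par t) = - L%:Z.
  by move=> /Lv tL; rewrite (lev_iter_par lev_par) /k; lia.
pose g := \sum_(t <- v) a t *: column t (k t).
have gr : graph (- L%:Z) (fin_comb v a) g.
  by apply: graph_sum => t tv; apply: graphZ; rewrite -(kE t tv); exact: graph_column.
rewrite -(kE t0 (mem_head _ _)) in gr.
rewrite -(fin_comb_norm a uv); apply: (@le_trans _ _ (l2norm g ^+ 2)); last first.
  by rewrite lerXn2r ?nnegrE ?l2norm_ge0// (graph_le gr).
apply: le_trans (l2norm_bound g ur); rewrite big_seq [leRHS]big_seq.
apply: ler_sum => u ur'; rewrite /g ell2_sum big_seq [in leRHS]big_seq.
rewrite (eq_bigr (fun t => (a t *: column t (k t)) u))// => t tv.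
rewrite ell2Z columnE 1?mulrC//; rewrite /k.
by have := Lv t tv; have := Lr u ur'; lia.
Qed.

(** Every Szego vector is a limit of finite combinations of basis vectors, on
    which the two descriptions of the adjoint agree. *)
Lemma adjoint_multiplier_value X c t0 u : bounded_op X ->
  (forall f, l2norm (X f) <= l2norm f) ->
  (forall t u, X (chi t) u = adjoint_entry_of u t) ->
  ball c -> lev u = lev t0 ->
  adjoint (s c) (szego_vec c (chi t0)) u = X (szego_vec c (chi t0)) u.
Proof.
move=> bX X1 XE bc ut; set phi := szego_vec c _.
have phi_ge : supp_ge (lev t0) phi.
  have gc := op_ball_geometric lev_preceq lev_par par_alpha bc.
  have := low_supp (bounded_szego bc) (low_adjoint_neumann gc)
    (@supp_ge_chi R T lev t0).
  by rewrite addr0.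
have gphi := graph_generator bc (@supp_at_chi R T lev t0).
apply/subr0_eq/normc_le0/ler_addgt0Pr => eps e0; rewrite add0r [leRHS]splitr.
have [v uv hv] := fin_comb_approx phi (divr_gt0 e0 (ltr0n R 2)).
pose k t := absz (lev t - lev t0)%R.
(* The terms with [lev t < lev t0] vanish; [graph] relates only the columns of
   nodes from that level on. *)
pose F t := if lev t0 <= lev t then phi t *: chi t else 0.
pose G t := if lev t0 <= lev t then phi t *: column t (k t) else 0.
have FE : fin_comb v phi = \sum_(t <- v) F t.
  apply: eq_bigr => t _; rewrite /F; case: leP => // tt0.
  by rewrite phi_ge// scale0r.
have gv : graph (lev t0) (fin_comb v phi) (\sum_(t <- v) G t).
  rewrite FE; apply: graph_sum => t _; rewrite /F /G; case: leP => tt0; last exact: graph0.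
  have -> : lev t0 = lev (iter (k t) par t).
    by rewrite (lev_iter_par lev_par) /k; lia.
  by apply: graphZ; exact: graph_column.
have GE : (\sum_(t <- v) G t) u = X (fin_comb v phi) u.
  rewrite FE lin_sum; last exact: bounded_lin.
  rewrite !ell2_sum; apply: eq_bigr => t _.
  rewrite /F /G; case: leP => tt0; last by rewrite lin0 ?ell20//; exact: bounded_lin.
  rewrite linZ; last exact: bounded_lin.
  by rewrite !ell2Z XE columnE// /k ut; lia.
apply: le_trans (normc_triangle ((\sum_(t <- v) G t) u) _ _) _; apply: lerD.
  rewrite -ell2B (le_trans (normc_le_l2norm _ _))//.
  have := graph_le (graphD gphi (graphZ (-1) gv)).
  by rewrite !scaleN1r => /le_trans; apply.
rewrite GE normcB -ell2B -linB; last exact: bounded_lin.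
by rewrite (le_trans (normc_le_l2norm _ _))// (le_trans (X1 _)).
Qed.

(** The value at [c] is read off on each level: there the Szego vector of
    [chi t] is [chi t] itself, and both [s c] and the evaluation of the
    multiplier preserve levels. *)
Lemma positive_kernel_multiplier : exists S : oper, schur_multiplier oo S /\
  forall c, ball c -> s c = point_eval oo alpha S c.
Proof.
have [X [bX X1 XE]] := adjoint_multiplier_exists.
have bS := bounded_adjoint bX; exists (adjoint X).
have lS : low lev 0 (adjoint X).
  move=> t u; rewrite addr0 => ut.
  by rewrite adjoint_entry// XE adjoint_entry_upper// conjC0.
split.
  split; first exact/(causalE lev_preceq).
  apply: le_trans (opnorm_adjoint bX) _; apply: opnorm_le => // f.
  by rewrite mul1r.
move=> c bc; have gc := op_ball_geometric lev_preceq lev_par par_alpha bc.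
rewrite (point_evalE lev_preceq lev_asymp lev_par par_alpha alpha_par)//.
set p := degree_part _ _ _.
have bN := bounded_neumann gc; have bNS := bounded_comp bN bS.
have bp : bounded_op p by exact: bounded_degree_part.
have hp : homog 0 p by exact: homog_degree_part.
have /(constant_opE lev_preceq)[bs hs] := s_const bc.
have [bsa hsa] := adjoint_value bc; have bpa := bounded_adjoint bp.
have hpa : homog 0 (adjoint p) by rewrite -oppr0; exact: homog_adjoint.
rewrite -(adjointK bs) -(adjointK bp); congr adjoint.
apply: op_entryP => // t u.
have [tu|tu] := eqVneq (lev u) (lev t); last by rewrite hsa ?hpa ?addr0.
pose phi := szego_vec c (chi t).
have phi_t v : lev v = lev t -> chi t v = phi v.
  move=> vt; have [_ NE _ _] := neumann_spec gc.
  rewrite adjoint_entry// NE /neumann_entry vt lexx subrr /= !chiE conjC_nat.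
  by rewrite eq_sym.
have loc A : bounded_op A -> homog 0 A -> A (chi t) u = A phi u.
  by move=> bA hA; apply: (homog_local bA hA) => v; rewrite addr0 tu; exact: phi_t.
rewrite !loc// /phi (adjoint_multiplier_value bX X1 XE bc tu).
rewrite (adjoint_eval_agree gc bS lS (@supp_at_chi R T lev t)) ?tu//.
by rewrite adjointK.
Qed.

End sufficiency.
(** * The interpolation theorem *)

Theorem theorem6p2 (R : realType) (q : nat) (q_ge1 : (1 <= q)%N)
  (T : choiceType) (e : rel T) (tree : homogeneous_tree q e)
  (oo : set (nat -> T)) (bd : boundary_point e oo)
  (alpha : 'I_q -> T -> T) (shifts : primitive_shifts oo alpha)
  (s : ('I_q -> oper R T) -> oper R T)
  (s_constant : forall c, op_ball oo alpha c -> constant_op oo (s c)) :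
  ((exists S : oper R T, schur_multiplier oo S /\
      forall c, op_ball oo alpha c -> s c = point_eval oo alpha S c)
   <-> positive_kernel oo alpha (schur_kernel alpha s))
  /\
  (forall S : oper R T, schur_multiplier oo S ->
     (forall c, op_ball oo alpha c -> s c = point_eval oo alpha S c) ->
     forall c d, op_ball oo alpha c -> op_ball oo alpha d ->
       schur_kernel alpha s c d =
       point_eval oo alpha (multiplier_kernel oo alpha S d) c).
Proof.
have [p _ _] := bd.
have lp := preceqE tree bd (p 0%N); have la := asympE tree bd (p 0%N).
have lpar := level_parent tree bd (p 0%N).
have pa := parent_alpha tree bd (p 0%N) shifts; have ap := alpha_onto tree bd (p 0%N) shifts.
have ai := alpha_inj tree bd (p 0%N) shifts.
split; last first.
  move=> S SS sE c d bc bd'.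
  exact: (schur_kernel_multiplier lp la lpar pa ap ai SS s_constant sE bc bd').
split=> [[S [SS sE]]|].
  exact: (multiplier_positive_kernel lp la lpar pa ap ai s_constant SS sE).
exact: (positive_kernel_multiplier lp la lpar pa ap ai s_constant).
Qed.
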